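(* Let $0<p<\infty$, $\lambda\ge 0$, let $A\in\mathbb{R}^{m\times n}$ have rows $a_1^T,\dots,a_m^T$ normalized to $\|a_i\|_2=1$ for each $i$, and let $0\neq b\in\mathcal{R}(A)$. The sequences $\{x_k\}$ generated by the weighted randomized sparse Kaczmarz method (WRaSK, with either the inexact or the exact step) described in the context converge linearly in expectation to the unique solution $\hat{x}$ of the regularized basis pursuit problem $$\min_{x\in\mathbb{R}^n}\ \lambda\|x\|_1+\tfrac12\|x\|_2^2\quad\text{subject to}\quad Ax=b$$ in the sense that $$\mathbb{E}\big(D_f^{x_{k+1}^*}(x_{k+1},\hat{x})\big)\le q\cdot\mathbb{E}\big(D_f^{x_k^*}(x_k,\hat{x})\big)$$ and $$\mathbb{E}\|x_k-\hat{x}\|_2\le q^{\frac{k}{2}}\sqrt{2\lambda\|\hat{x}\|_1+\|\hat{x}\|_2^2},$$ where the convergence factor is $$q=1-\frac12\cdot\widetilde{\sigma}_{\min}^2(A)\cdot\frac{|\hat{x}|_{\min}}{|\hat{x}|_{\min}+2\lambda}\cdot\inf_{z\neq 0}\frac{\|Az\|_{l_{p+2}}^{p+2}}{\|Az\|_{l_p}^{p}\,\|Az\|_2^{2}},$$ and $z=x-\hat{x}$ (with $x\in\mathbb{R}^n$, $x\ne\hat{x}$). Moreover, WRaSK is at least as efficient as the randomized sparse Kaczmarz method (RaSK, see the context) due to $$\inf_{z\neq 0}\frac{\|Az\|_{l_{p+2}}^{p+2}}{\|Az\|_{l_p}^{p}\,\|Az\|_2^{2}}\ \ge\ \frac1m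 ,$$ where the minimum $\frac1m$ is attainable if and only if $Az$ is the constant multiple of unit vector.
   Context: Notation: $f(x)=\lambda\|x\|_1+\frac12\|x\|_2^2$ on $\mathbb{R}^n$, with conjugate $f^*(x^* )=\sup_x\{\langle x^*,x\rangle-f(x)\}=\frac12\|S_\lambda(x^* )\|_2^2$, where $S_\lambda(x)=\max\{|x|-\lambda,0\}\cdot\mathrm{sign}(x)$ is the componentwise soft shrinkage operator, and $\nabla f^*=S_\lambda$. For $x,y\in\mathbb{R}^n$ and $x^*\in\partial f(x)$, the Bregman distance is $D_f^{x^*}(x,y)=f(y)-f(x)-\langle x^*,y-x\rangle$. For a vector $v$, $\|v\|_{l_p}^p=\sum_i|v_i|^p$ for all $0<p<\infty$. $\mathcal{R}(A)$ is the range of $A$. In the infima over $z\neq0$ the quotient is considered for those $z$ with $Az\neq 0$. $\sigma_{\min}(B)$ denotes the smallest nonzero singular value of a nonzero matrix $B$; $A_J$ is the submatrix of $A$ formed by the columns indexed by $J$; $\widetilde{\sigma}_{\min}(A)=\min\{\sigma_{\min}(A_J): J\subset\{1,\dots,n\},\ A_J\neq 0\}$; $|\hat{x}|_{\min}=\min\{|\hat{x}_j|:\hat{x}_j\neq 0\}>0$ (since $b\neq 0$, $\hat{x}\neq 0$). Weighted randomized sparse Kaczmarz method (WRaSK): start with $x_0=x_0^*=0\in\mathbb{R}^n$. For $k=0,1,2,\dots$: choose a random index $i_k\in\{1,\dots,m\}$, where $i_k=i$ has probability $p_i=\frac{|\langle a_i,x_k\rangle-b_i|^p}{\|Ax_k-b\|_{l_p}^p}$;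 compute a step size $t_k$, either by the inexact step $t_k=\langle a_{i_k},x_k\rangle-b_{i_k}$, or by the exact step $t_k=\arg\min_{t\in\mathbb{R}}\{f^*(x_k^*-t\,a_{i_k})+t\,b_{i_k}\}$; set $x_{k+1}^*=x_k^*-t_k a_{i_k}$ and $x_{k+1}=S_\lambda(x_{k+1}^* )$ (so $x_k^*\in\partial f(x_k)$ for all $k$). If $Ax_k=b$, the iteration is understood to stop, i.e. $x_{k+1}=x_k$, $x_{k+1}^*=x_k^*$. The expectation is over the random indices. Randomized sparse Kaczmarz method (RaSK): the same iteration, but with $i_k=i$ chosen with probability $\|a_i\|_2^2/\|A\|_F^2$, which equals $1/m$ for normalized rows ($\|\cdot\|_F$ is the Frobenius norm). Its known convergence factor is $1-\frac12\cdot\frac1m\cdot\widetilde{\sigma}_{\min}^2(A)\cdot\frac{|\hat{x}|_{\min}}{|\hat{x}|_{\min}+2\lambda}$ for normalized rows; ''at least as efficient'' refers to the comparison of $q$ with this factor.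
   Formalization: In the equality case, ''constant multiple of unit vector'' is replaced by ''constant multiple of a vector whose entries all have absolute value 1'', since the usual readings (Euclidean unit vector, standard basis vector, all-ones vector) make the equivalence false. *)

(* Defs.v *)
From HB Require Import structures.
From mathcomp Require Import all_boot all_order all_algebra.
From mathcomp Require Import all_classical all_reals all_analysis.

Set Implicit Arguments.
Unset Strict Implicit.
Unset Printing Implicit Defensive.

Import Order.TTheory GRing.Theory Num.Theory.
Import numFieldNormedType.Exports.

Local Open Scope classical_set_scope.
Local Open Scope ring_scope.

Section Vectors.
Context {R : realType}.

Definition dot n (u v : 'cV[R]_n) : R := \sum_i u i 0 * v i 0.

Definition l1norm n (v : 'cV[R]_n) : R := \sum_i `|v i 0|.

(* The library norm `|v| on matrices is the max norm. *)
Definition l2norm n (v : 'cV[R]_n) : R := Num.sqrt (\sum_i v i 0 ^+ 2).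

(* ||v||_{l_p}^p, also for 0 < p < 1. *)
Definition lpnorm_p (p : R) n (v : 'cV[R]_n) : R := \sum_i `|v i 0| `^ p.

(* The vector a_i, where a_i^T is the i-th row of A. *)
Definition arow m n (A : 'M[R]_(m, n)) (i : 'I_m) : 'cV[R]_n := (row i A)^T.

Definition absmin n (x : 'cV[R]_n) : R :=
  inf [set `|x j 0| | j in [set j | x j 0 != 0]].

(* The singular values of B are the s >= 0 such that s^2 is an eigenvalue of
   B^T B.  For B != 0 the set is finite and nonempty, so inf is a minimum. *)
Definition sigma_min m n (B : 'M[R]_(m, n)) : R :=
  inf [set s | 0 < s /\ eigenvalue (B^T *m B) (s ^+ 2)].

Definition colsubset m n (A : 'M[R]_(m, n)) (J : {set 'I_n}) : 'M[R]_(m, #|J|) :=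
  colsub (fun j : 'I_#|J| => enum_val j) A.

Definition sigma_tilde_min m n (A : 'M[R]_(m, n)) : R :=
  inf [set sigma_min (colsubset A J) | J in [set J | colsubset A J != 0]].

End Vectors.

Section SparseKaczmarz.
Context {R : realType}.
Variables (lam : R) (n : nat).
Implicit Types x y xs : 'cV[R]_n.

Definition objective x : R := lam * l1norm x + l2norm x ^+ 2 / 2.

Definition conjugate xs : R := sup [set dot xs x - objective x | x in setT].

Definition soft_shrinkage x : 'cV[R]_n :=
  \col_j (Num.max (`|x j 0| - lam) 0 * Num.sg (x j 0)).

(* D_f^{xs}(x, y), for xs a subgradient of the objective at x. *)
Definition bregman xs x y : R := objective y - objective x - dot xs (y - x).

Definition bp_solution m (A : 'M[R]_(m, n)) (b : 'cV[R]_m) x : Prop :=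
  A *m x = b /\ forall y, A *m y = b -> objective x <= objective y.

Definition wrask_prob (p : R) m (A : 'M[R]_(m, n)) (b : 'cV[R]_m) x (j : 'I_m) : R :=
  `|dot (arow A j) x - b j 0| `^ p / lpnorm_p p (A *m x - b).

Inductive step_rule := InexactStep | ExactStep.

(* The exact step is a relation: the minimizer need not be unique when the
   chosen component of b vanishes. *)
Definition is_step (r : step_rule) m (A : 'M[R]_(m, n)) (b : 'cV[R]_m)
    x xs (j : 'I_m) (t : R) : Prop :=
  match r with
  | InexactStep => t = dot (arow A j) x - b j 0
  | ExactStep => forall s : R,
      conjugate (xs - t *: arow A j) + t * b j 0
        <= conjugate (xs - s *: arow A j) + s * b j 0
  end.

(* Outcomes with the same first k indices as w. *)
Definition same_past (T : Type) m (i : nat -> T -> 'I_m) (k : nat) (w : T) : set T :=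
  [set w' | forall l, (l < k)%N -> i l w' = i l w].

(* The process (x_k, xs_k) driven by the random indices i_k on (T, P).  By
   wrask_past the iterates are functions of i_0, ..., i_(k-1) alone, whatever
   the choice among several exact steps; as there are finitely many pasts,
   wrask_law says that i_k has conditional law p_j given i_0, ..., i_(k-1).
   It is not imposed once A x_k = b, where p_j would be 0 / 0 and the
   iteration has stopped. *)
Record wrask (r : step_rule) (p : R) m (A : 'M[R]_(m, n)) (b : 'cV[R]_m)
    (d : measure_display) (T : measurableType d) (P : probability T R)
    (i : nat -> T -> 'I_m) (x xs : nat -> T -> 'cV[R]_n) : Prop := Wrask {
  wrask_meas : forall k j, measurable [set w | i k w = j];
  wrask_init : forall w, x 0%N w = 0 /\ xs 0%N w = 0;
  wrask_past : forall k w w', same_past i k w w' -> xs k w' = xs k w;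
  wrask_law : forall k w j, A *m x k w <> b ->
    P (same_past i k w `&` [set w' | i k w' = j])
      = ((wrask_prob p A b (x k w) j)%:E * P (same_past i k w))%E;
  wrask_step : forall k w, A *m x k w <> b ->
    (exists2 t, is_step r A b (x k w) (xs k w) (i k w) t
              & xs k.+1 w = xs k w - t *: arow A (i k w))
    /\ x k.+1 w = soft_shrinkage (xs k.+1 w);
  wrask_stop : forall k w, A *m x k w = b ->
    x k.+1 w = x k w /\ xs k.+1 w = xs k w
}.

Definition norm_quotient (p : R) m (A : 'M[R]_(m, n)) (z : 'cV[R]_n) : R :=
  lpnorm_p (p + 2) (A *m z) / (lpnorm_p p (A *m z) * l2norm (A *m z) ^+ 2).

Definition norm_quotient_inf (p : R) m (A : 'M[R]_(m, n)) : R :=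
  inf [set norm_quotient p A z | z in [set z | z != 0 /\ A *m z != 0]].

Definition wrask_factor (p : R) m (A : 'M[R]_(m, n)) (xhat : 'cV[R]_n) : R :=
  1 - 2^-1 * sigma_tilde_min A ^+ 2 * (absmin xhat / (absmin xhat + 2 * lam))
      * norm_quotient_inf p A.

(* For rows of Euclidean norm 1, sampled uniformly. *)
Definition rask_factor m (A : 'M[R]_(m, n)) (xhat : 'cV[R]_n) : R :=
  1 - 2^-1 * m%:R^-1 * sigma_tilde_min A ^+ 2
      * (absmin xhat / (absmin xhat + 2 * lam)).

End SparseKaczmarz.

(* Main.v *)
Require Import Defs.
From mathcomp Require Import all_boot all_order all_algebra.
From mathcomp Require Import all_classical all_reals all_analysis.
From mathcomp Require Import ring lra measurable_realfun.
Import Order.TTheory GRing.Theory Num.Theory.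
Import numFieldNormedType.Exports.
Set Implicit Arguments.
Unset Strict Implicit.
Unset Printing Implicit Defensive.
Local Open Scope classical_set_scope.
Local Open Scope ring_scope.

(* The dual iterate satisfies xs_k = A^T y_k and x_k = S_lam (xs_k), and the
   Bregman distance to xhat is the dual gap
   f^*(A^T y) - <b, y> + f(xhat).  As f^* is 1-smooth, a step on row j, inexact
   or exact, lowers it by at least (<a_j, x_k> - b_j)^2 / 2, so the mean
   decrease over the law p_j is at least half of the infimum of the norm
   quotient times |A x_k - b|^2.

   It remains to bound the Bregman distance by |A x - b|^2.  Project y onto the
   polyhedron of dual solutions.  By Farkas and Caratheodory, the difference h
   is A w with w supported on linearly independent columns and with the signs
   of the active constraints; hence sigma_tilde^2 |w|^2 <= |h|^2, while each
   coordinate with w_j <a_j, h> > 0 satisfies the strong monotonicity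
   c <a_j, h>^2 <= (x_j - xhat_j) <a_j, h>, c = |xhat|_min / (|xhat|_min + 2 lam).
   Then |h|^2 = <w, A^T h> gives c sigma_tilde^2 |h|^2 <= <h, A x - b>, and
   the Bregman distance is at most <h, A x - b>.  The dual solution exists
   because f^* grows quadratically on the range of A^T. *)

(** * Inner product and the range of a transpose *)

Section DotProduct.
Context {R : realType}.

Lemma dotE n (u v : 'cV[R]_n) : dot u v = (u^T *m v) 0 0.
Proof. by rewrite /dot mxE; apply: eq_bigr => i _; rewrite mxE. Qed.

Lemma dotC n (u v : 'cV[R]_n) : dot u v = dot v u.
Proof. by apply: eq_bigr => i _; rewrite mulrC. Qed.

Lemma dotDr n (u v w : 'cV[R]_n) : dot u (v + w) = dot u v + dot u w.
Proof. by rewrite !dotE mulmxDr mxE. Qed.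

Lemma dotDl n (u v w : 'cV[R]_n) : dot (v + w) u = dot v u + dot w u.
Proof. by rewrite -!(dotC u) dotDr. Qed.

Lemma dotZr n a (u v : 'cV[R]_n) : dot u (a *: v) = a * dot u v.
Proof. by rewrite !dotE -scalemxAr mxE. Qed.

Lemma dotZl n a (u v : 'cV[R]_n) : dot (a *: u) v = a * dot u v.
Proof. by rewrite -!(dotC v) dotZr. Qed.

Lemma dotNr n (u v : 'cV[R]_n) : dot u (- v) = - dot u v.
Proof. by rewrite -scaleN1r dotZr mulN1r. Qed.

Lemma dotNl n (u v : 'cV[R]_n) : dot (- u) v = - dot u v.
Proof. by rewrite -!(dotC v) dotNr. Qed.

Lemma dotBr n (u v w : 'cV[R]_n) : dot u (v - w) = dot u v - dot u w.
Proof. by rewrite dotDr dotNr. Qed.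

Lemma dotBl n (u v w : 'cV[R]_n) : dot (v - w) u = dot v u - dot w u.
Proof. by rewrite dotDl dotNl. Qed.

Lemma dot0r n (u : 'cV[R]_n) : dot u 0 = 0.
Proof. by rewrite dotE mulmx0 mxE. Qed.

Lemma dot0l n (u : 'cV[R]_n) : dot 0 u = 0.
Proof. by rewrite dotC dot0r. Qed.

Lemma dot_mulmxr m n (M : 'M[R]_(m, n)) u v : dot u (M *m v) = dot (M^T *m u) v.
Proof. by rewrite !dotE trmx_mul trmxK mulmxA. Qed.

Lemma dot_mulmxl m n (M : 'M[R]_(m, n)) u v : dot (M *m v) u = dot v (M^T *m u).
Proof. by rewrite dotC dot_mulmxr dotC. Qed.

Lemma dot_ge0 n (u : 'cV[R]_n) : 0 <= dot u u.
Proof. by apply: sumr_ge0 => i _; rewrite -expr2 sqr_ge0. Qed.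

Lemma dot_eq0 n (u : 'cV[R]_n) : (dot u u == 0) = (u == 0).
Proof.
apply/eqP/eqP => [|->]; last exact: dot0r.
move=> u0; apply/colP => i; rewrite mxE.
have /(_ i isT)/eqP : forall j, true -> u j 0 * u j 0 = 0.
  by apply: psumr_eq0P u0 => j _; rewrite -expr2 sqr_ge0.
by rewrite mulf_eq0 orbb => /eqP.
Qed.

Lemma dot_gt0 n (u : 'cV[R]_n) : (0 < dot u u) = (u != 0).
Proof. by rewrite lt_def dot_ge0 andbT dot_eq0. Qed.

Lemma l2norm_sqr n (u : 'cV[R]_n) : l2norm u ^+ 2 = dot u u.
Proof.
rewrite /l2norm sqr_sqrtr; last by apply: sumr_ge0 => i _; rewrite sqr_ge0.
by apply: eq_bigr => i _; rewrite expr2.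
Qed.

Lemma dot_CauchySchwarz n (u v : 'cV[R]_n) : dot u v ^+ 2 <= dot u u * dot v v.
Proof.
have [->|v0] := eqVneq v 0; first by rewrite !dot0r expr0n mulr0.
have vv : 0 < dot v v by rewrite dot_gt0.
have := dot_ge0 (dot v v *: u - dot u v *: v).
rewrite !(dotBl, dotBr, dotZl, dotZr) (dotC v u) => H.
by rewrite -(ler_pM2l vv) -subr_ge0; apply: le_trans H _; rewrite le_eqVlt; apply/orP;
  left; apply/eqP; ring.
Qed.

Lemma dot_arow m n (A : 'M[R]_(m, n)) i x : dot (arow A i) x = (A *m x) i 0.
Proof. by rewrite /dot mxE; apply: eq_bigr => j _; rewrite !mxE. Qed.

Lemma mulmx_trE m n (A : 'M[R]_(m, n)) y j : (A^T *m y) j 0 = dot (col j A) y.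
Proof. by rewrite /dot mxE; apply: eq_bigr => i _; rewrite !mxE. Qed.

Lemma exists_entry_neq0 n (v : 'cV[R]_n) : v != 0 -> exists j, v j 0 != 0.
Proof.
move=> v0; apply: contrapT => H; move/eqP: v0; apply; apply/colP => j.
by rewrite mxE; apply: contrapT => /eqP vj; apply: H; exists j.
Qed.

Lemma exists_col_neq0 m n (A : 'M[R]_(m, n)) : A != 0 -> exists j, col j A != 0.
Proof.
move=> A0; apply: contrapT => H; move/eqP: A0; apply; apply/matrixP => i j; rewrite mxE.
apply: contrapT => /eqP Aij; apply: H; exists j.
by apply: contraNneq Aij => /colP/(_ i); rewrite !mxE => ->.
Qed.

(** The columns of [cokermx A] lie in the kernel of [A], so the hypothesis yields
    [v^T *m cokermx A = 0], the criterion for membership in the row space. *)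
Lemma orthogonal_ker m n (A : 'M[R]_(m, n)) (v : 'cV[R]_n) :
  (forall k, A *m k = 0 -> dot k v = 0) -> exists y, v = A^T *m y.
Proof.
move=> vk; have /submxP[D vD] : (v^T <= A)%MS.
  rewrite submxE; apply/eqP/matrixP => i j; rewrite [RHS]mxE !ord1.
  have {vk} := vk (col j (cokermx A)).
  rewrite colE mulmxA mulmx_coker mul0mx dotC dotE mulmxA -colE mxE.
  by apply.
by exists D^T; rewrite -[LHS]trmxK vD trmx_mul.
Qed.

End DotProduct.

(** * Scalar soft thresholding *)

Section SoftThreshold.
Context {R : realType}.
Variable lam : R.

Definition soft (s : R) : R := Num.max (`|s| - lam) 0 * Num.sg s.

Variant soft_spec (s : R) : R -> Type :=
| SoftPos of lam < s : soft_spec s (s - lam)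
| SoftNeg of s < - lam : soft_spec s (s + lam)
| SoftZero of - lam <= s & s <= lam : soft_spec s 0.

Lemma softP (lam_ge0 : 0 <= lam) s : soft_spec s (soft s).
Proof.
rewrite /soft; case: (ltP lam s) => [ls|sl].
  have s0 : 0 < s by lra.
  rewrite gtr0_norm // gtr0_sg // mulr1 max_l; last by lra.
  by constructor.
case: (ltP s (- lam)) => [ls|sl'].
  have s0 : s < 0 by lra.
  rewrite ltr0_norm // ltr0_sg // max_l; last by lra.
  by rewrite (_ : (- s - lam) * -1 = s + lam); [constructor | ring].
rewrite max_r ?mul0r; first by constructor.
by rewrite subr_le0 ler_norml sl sl'.
Qed.

(** After expanding squares this says that [s - soft s] is a subgradient of [lam * |.|] at [soft s];
    the last square on the left is the strong convexity contributed by [x ^+ 2 / 2]. *)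
Lemma soft_subgradient (lam_ge0 : 0 <= lam) s x :
  lam * `|soft s| + soft s ^+ 2 / 2 + s * (x - soft s) + (x - soft s) ^+ 2 / 2
    <= lam * `|x| + x ^+ 2 / 2.
Proof.
suff : (s - soft s) * (x - soft s) <= lam * (`|x| - `|soft s|) by lra.
case: (softP lam_ge0) => [ls|ls|l1 l2].
- rewrite [in leRHS](gtr0_norm (x := s - lam)); last by lra.
  rewrite (_ : s - (s - lam) = lam); last by ring.
  by apply: ler_wpM2l => //; have := ler_norm x; lra.
- rewrite (_ : s - (s + lam) = - lam); last by ring.
  rewrite [in leRHS](ltr0_norm (x := s + lam)); last by lra.
  by rewrite mulNr -mulrN; apply: ler_wpM2l => //; have := ler_norm (- x);
    rewrite normrN; lra.
- rewrite normr0 !subr0; apply: le_trans (ler_norm _) _; rewrite normrM.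
  by apply: ler_wpM2r => //; rewrite ler_norml l1 l2.
Qed.

Lemma soft_self (lam_ge0 : 0 <= lam) s : (s - soft s) * soft s = lam * `|soft s|.
Proof.
case: (softP lam_ge0) => [ls|ls|l1 l2].
- by rewrite gtr0_norm; [ring | lra].
- by rewrite ltr0_norm; [ring | lra].
- by rewrite normr0; ring.
Qed.

(** The function [soft s ^+ 2 / 2] has derivative [soft], which is 1-Lipschitz. *)
Lemma soft_smooth (lam_ge0 : 0 <= lam) s d :
  soft (s + d) ^+ 2 / 2 <= soft s ^+ 2 / 2 + d * soft s + d ^+ 2 / 2.
Proof. by case: (softP lam_ge0 s); case: (softP lam_ge0 (s + d)); nra. Qed.

Lemma soft_homo (lam_ge0 : 0 <= lam) : {homo soft : s t / s <= t}.
Proof.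
by move=> s t; case: (softP lam_ge0 s); case: (softP lam_ge0 t); lra.
Qed.

Lemma soft_monotone (lam_ge0 : 0 <= lam) s t : 0 <= (soft s - soft t) * (s - t).
Proof.
have [/[dup]/(soft_homo lam_ge0)|/ltW/[dup]/(soft_homo lam_ge0)] := leP s t => st1 st2.
  by apply: mulr_le0; rewrite subr_le0.
by apply: mulr_ge0; rewrite subr_ge0.
Qed.

(** The secant slope of [soft] from [t] is smallest when [s] is the far end of the dead zone: [soft]
    then changes by [|soft t|] while its argument moves by [|soft t| + 2 * lam]. *)
Lemma soft_strong_monotone (lam_ge0 : 0 <= lam) c s t : 0 <= c -> c <= 1 ->
  c * (`|soft t| + 2 * lam) <= `|soft t| -> soft t != 0 ->
  c * (s - t) ^+ 2 <= (soft s - soft t) * (s - t).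
Proof.
move=> c0 c1 H t0; rewrite expr2 mulrA.
suff : (s <= t /\ c * (t - s) <= soft t - soft s) \/
       (t <= s /\ c * (s - t) <= soft s - soft t).
  move=> [][st]; rewrite -subr_ge0 in st => /(ler_wpM2r st); last by [].
  by rewrite -[leLHS]mulrNN -[leRHS]mulrNN -mulrN !opprB.
move: H t0; case: (softP lam_ge0 t) => [lt|lt|_ _]; last by rewrite eqxx.
- rewrite gtr0_norm; last lra.
  move=> H _; case: (softP lam_ge0 s) => [ls|ls|l1 l2]; last by left; nra.
  + by have [|/ltW] := leP s t => st; [left|right]; nra.
  + by left; nra.
- rewrite ltr0_norm; last lra.
  move=> H _; case: (softP lam_ge0 s) => [ls|ls|l1 l2]; last by right; nra.
  + by right; nra.
  + by have [|/ltW] := leP s t => st; [left|right]; nra.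
Qed.

Lemma soft_pos_boundary (lam_ge0 : 0 <= lam) d : 0 <= d -> soft (lam + d) = d.
Proof.
move=> d0; case: (softP lam_ge0) => [ls|ls|l1 l2]; [ring | lra | lra].
Qed.

Lemma soft_neg_boundary (lam_ge0 : 0 <= lam) d : d <= 0 -> soft (- lam + d) = d.
Proof.
move=> d0; case: (softP lam_ge0) => [ls|ls|l1 l2]; [lra | ring | lra].
Qed.

Lemma soft_eq0 (lam_ge0 : 0 <= lam) s : soft s = 0 <-> `|s| <= lam.
Proof.
rewrite ler_norml; case: (softP lam_ge0) => [ls|ls|-> ->]; split=> // ?; lra.
Qed.

End SoftThreshold.

(** * Conjugate and Bregman distance of the objective *)

Section Objective.
Context {R : realType}.
Variables (lam : R) (n : nat).
Implicit Types x y xs : 'cV[R]_n.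

Lemma soft_shrinkageE xs j : soft_shrinkage lam xs j 0 = soft lam (xs j 0).
Proof. by rewrite mxE. Qed.

Lemma objectiveE x : objective lam x = \sum_j (lam * `|x j 0| + x j 0 ^+ 2 / 2).
Proof.
by rewrite /objective l2norm_sqr /l1norm /dot mulr_sumr mulr_suml -big_split.
Qed.

Lemma bregman_ge (lam_ge0 : 0 <= lam) xs x y : x = soft_shrinkage lam xs ->
  dot (y - x) (y - x) / 2 <= bregman lam xs x y.
Proof.
move=> ->; rewrite /bregman !objectiveE /dot mulr_suml -!sumrB; apply: ler_sum => j _.
rewrite !mxE -/(soft lam (xs j 0)).
by have := soft_subgradient lam_ge0 (xs j 0) (y j 0); lra.
Qed.

(** The supremum is attained at [soft_shrinkage lam xs]: the deficit of any other [x] is a Bregman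
    distance, non-negative by [bregman_ge]. *)
Lemma conjugateE (lam_ge0 : 0 <= lam) xs : conjugate lam xs = \sum_j soft lam (xs j 0) ^+
  2 / 2.
Proof.
set s := \sum_j _.
have sE : dot xs (soft_shrinkage lam xs) - objective lam (soft_shrinkage lam xs) = s.
  rewrite objectiveE /dot -sumrB; apply: eq_bigr => j _; rewrite !mxE -/(soft lam _).
  by have := soft_self lam_ge0 (xs j 0); lra.
have ub : ubound [set dot xs x - objective lam x | x in setT] s.
  move=> _ [x _ <-].
  have := bregman_ge lam_ge0 x (erefl (soft_shrinkage lam xs)).
  rewrite /bregman (dotBr xs) -sE; have := dot_ge0 (x - soft_shrinkage lam xs); lra.
apply/eqP; rewrite eq_le; apply/andP; split.
  by apply: ge_sup => //; exists s, (soft_shrinkage lam xs).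
by apply: ub_le_sup; [exists s | exists (soft_shrinkage lam xs)].
Qed.

(** Fenchel equality eliminates [x], so the distance becomes a function of the dual vector [xs]
    alone. *)
Lemma bregmanE (lam_ge0 : 0 <= lam) xs x y : x = soft_shrinkage lam xs ->
  bregman lam xs x y = objective lam y - dot xs y + conjugate lam xs.
Proof.
move=> ->; rewrite (conjugateE lam_ge0) /bregman dotBr.
suff : dot xs (soft_shrinkage lam xs) - objective lam (soft_shrinkage lam xs) =
  \sum_j soft lam (xs j 0) ^+ 2 / 2 by lra.
rewrite objectiveE /dot -sumrB; apply: eq_bigr => j _; rewrite !mxE -/(soft lam _).
by have := soft_self lam_ge0 (xs j 0); lra.
Qed.

(** The two opposite Bregman distances add up to the right-hand side, and the one from [y] to [x] is
    non-negative. *)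
Lemma bregman_le (lam_ge0 : 0 <= lam) xs ys x y : x = soft_shrinkage lam xs -> y =
  soft_shrinkage lam ys ->
  bregman lam xs x y <= dot (xs - ys) (x - y).
Proof.
move=> _ yE; have := bregman_ge lam_ge0 x yE.
have := dot_ge0 (x - y).
by rewrite /bregman !(dotBr, dotBl); lra.
Qed.

Lemma conjugate_smooth (lam_ge0 : 0 <= lam) xs d :
  conjugate lam (xs + d) <=
    conjugate lam xs + dot d (soft_shrinkage lam xs) + dot d d / 2.
Proof.
rewrite !(conjugateE lam_ge0) /dot mulr_suml -!big_split; apply: ler_sum => j _ /=.
by rewrite !mxE -/(soft lam _); have := soft_smooth lam_ge0 (xs j 0) (d j 0); lra.
Qed.

End Objective.

(** * Existence of minimizers; the least singular value as a minimum *)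

Section Minimizers.
Context {R : realType}.

Lemma continuous_sumf (V : topologicalType) I (r : seq I) (F : I -> V -> R) :
  (forall i, continuous (F i)) -> continuous (fun v => \sum_(i <- r) F i v).
Proof.
move=> cF; elim: r => [|i r IHr] v.
  by under eq_fun do rewrite big_nil; exact: cvg_cst.
under eq_fun do rewrite big_cons.
by apply: continuousD; [exact: cF | exact: IHr].
Qed.

Lemma continuous_dot n (u : 'cV[R]_n) : continuous (dot u).
Proof.
apply: continuous_sumf => i v.
by apply: continuousM; [exact: cst_continuous | exact: coord_continuous].
Qed.

Lemma continuous_dot_sqr n : continuous (fun u : 'cV[R]_n => dot u u).
Proof.
apply: continuous_sumf => i v.
by apply: continuousM; exact: coord_continuous.
Qed.

Lemma trmx_continuous m n : continuous (@trmx R m n).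
Proof.
move=> v s /nbhs_ballP [e e0 es]; apply/nbhs_ballP; exists e => //= w [_ vw].
by apply: es; split=> // i j; rewrite !mxE; exact: vw.
Qed.

Lemma exists_minimizer n (F : 'cV[R]_n -> R) (C : set 'cV[R]_n) y0 M :
  continuous F -> closed C -> C y0 ->
  (forall y, C y -> F y <= F y0 -> forall j, `|y j 0| <= M) ->
  exists2 y, C y & forall z, C z -> F y <= F z.
Proof.
move=> cF clC Cy0 CM.
(* The box is compact by [rV_compact], which speaks of row vectors; transposition carries this over
   to columns. *)
pose K : set 'rV[R]_n := [set v | forall i, `[- M, M]%classic (v 0 i)].
have cK : compact (trmx @` K).
  apply: continuous_compact; first exact/continuous_subspaceT/trmx_continuous.
  by apply: (@rV_compact _ _ (fun=> `[- M, M]%classic)) => i; exact: segment_compact.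
have inK z : C z -> F z <= F y0 -> (trmx @` K `&` C) z.
  move=> Cz zy0; split=> //; exists z^T; last exact: trmxK.
  by move=> i /=; rewrite mxE in_itv /= -ler_norml; exact: CM.
have [] := @compact_EVT_min _ R F (trmx @` K `&` C).
- by exists y0; exact: inK.
- exact: compact_closedI.
- exact: continuous_subspaceT.
move=> c; rewrite inE => -[_ Cc] minc; exists c => // z Cz.
have [zy0|/ltW y0z] := leP (F z) (F y0); first by apply: minc; rewrite inE; exact: inK.
by apply: le_trans y0z; apply: minc; rewrite inE; exact: inK.
Qed.

Lemma sqr_entry_le n (y : 'cV[R]_n) j : y j 0 ^+ 2 <= dot y y.
Proof.
rewrite /dot (bigD1 j) //= -expr2 lerDl.
by apply: sumr_ge0 => i _; rewrite -expr2 sqr_ge0.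
Qed.

Lemma norm_entry_le n (y : 'cV[R]_n) j K : dot y y <= K -> `|y j 0| <= K + 1.
Proof.
move=> yK; have := le_trans (sqr_entry_le y j) yK.
rewrite -[leLHS](real_normK (num_real _)); have := sqr_ge0 (`|y j 0| - 1); nra.
Qed.

Lemma linear_coef_eq0 (a c : R) : (forall t, 0 <= t * a + t ^+ 2 * c) -> a = 0.
Proof.
move=> H; apply/eqP; apply: contraT => a0.
have [C C0 cC] : exists2 C, 0 < C & c < C.
  by exists (`|c| + 1); [rewrite ltr_pwDr | have := ler_norm c; lra].
have Cn0 : C != 0 by rewrite gt_eqF.
(* As [C] exceeds both 0 and [c], the quadratic is negative at this [t] when [a] is nonzero. *)
have := H (- a / C).
have -> : - a / C * a + (- a / C) ^+ 2 * c = (a / C) ^+ 2 * (c - C) by field.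
rewrite pmulr_rge0; first by lra.
by rewrite exprn_even_gt0 //= mulf_neq0 ?invr_eq0.
Qed.

(** This is the range of [B^T], written as an intersection of hyperplanes so that closedness is
    immediate. *)
Definition kerperp m n (B : 'M[R]_(m, n)) : set 'cV[R]_n :=
  [set v | forall k, B *m k = 0 -> dot k v = 0].

Lemma closed_kerperp m n (B : 'M[R]_(m, n)) : closed (kerperp B).
Proof.
rewrite (_ : kerperp B = \bigcap_(k in [set k | B *m k = 0]) (dot k @^-1` [set 0])).
  apply: closed_bigI => k _; apply: preimage_closed; last exact: closed_eq.
  by move=> v _; exact: continuous_dot.
by apply/seteqP; split.
Qed.

Lemma kerperpD m n (B : 'M[R]_(m, n)) u v a :
  kerperp B u -> kerperp B v -> kerperp B (u + a *: v).
Proof. by move=> Bu Bv k Bk; rewrite dotDr dotZr Bu // Bv // mulr0 addr0. Qed.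

Lemma kerperp_tr m n (B : 'M[R]_(m, n)) y : kerperp B (B^T *m y).
Proof. by move=> k Bk; rewrite dot_mulmxr trmxK Bk dot0l. Qed.

Lemma kerperpZ m n (B : 'M[R]_(m, n)) v a : kerperp B v -> kerperp B (a *: v).
Proof. by move=> Bv k Bk; rewrite dotZr Bv // mulr0. Qed.

(** Minimise [|B y|^2] over the unit vectors of [kerperp B]. The minimum is positive because
    [kerperp B] meets the kernel only in 0, and a minimizer is an eigenvector by stationarity. *)
Lemma exists_min_singular m n (B : 'M[R]_(m, n)) : B != 0 ->
  exists mu, [/\ 0 < mu, exists2 v : 'cV[R]_n, v != 0 & B^T *m B *m v = mu *: v &
    forall y, kerperp B y -> mu * dot y y <= dot (B *m y) (B *m y)].
Proof.
move=> B0.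
pose C := [set y : 'cV[R]_n | dot y y = 1] `&` kerperp B.
have normalize z : kerperp B z -> z != 0 -> C ((Num.sqrt (dot z z))^-1 *: z).
  move=> Bz z0; split; last exact: kerperpZ.
  have zz : 0 < dot z z by rewrite dot_gt0.
  rewrite /= dotZl dotZr mulrA -expr2 exprVn (sqr_sqrtr (ltW zz)) mulVf // gt_eqF //.
have [y0 Cy0] : C !=set0.
  have [i [j Bij]] : exists i j, B i j != 0.
    apply: contrapT => H; move/eqP: B0; apply; apply/matrixP => i j; rewrite mxE.
    by apply: contrapT => /eqP Bij; apply: H; exists i, j.
  exists ((Num.sqrt (dot (arow B i) (arow B i)))^-1 *: arow B i).
  apply: normalize.
    by move=> k Bk; rewrite dotC dot_arow Bk mxE.
  by apply: contra Bij => /eqP/colP/(_ j); rewrite !mxE => /eqP.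
pose F y := dot (B *m y) (B *m y).
have clC : closed C.
  apply: closedI; last exact: closed_kerperp.
  rewrite (_ : mkset _ = (fun y => dot y y) @^-1` [set 1]) //.
  apply: preimage_closed; last exact: closed_eq.
  by move=> v _; exact: continuous_dot_sqr.
have cF : continuous F.
  rewrite /F (_ : (fun y => _) = fun y => \sum_i dot (arow B i) y * dot (arow B i) y).
    by apply: continuous_sumf => i v; apply: continuousM; exact: continuous_dot.
  by apply/funext => y; apply: eq_bigr => i _; rewrite !dot_arow.
have [] := exists_minimizer cF clC Cy0 (M := 1 + 1).
  by move=> y [y1 _] _ j; apply: norm_entry_le; rewrite y1.
move=> y [/= y1 By] minF.
have minV z : kerperp B z -> F y * dot z z <= F z.
  move=> Bz; have [->|z0] := eqVneq z 0; first by rewrite dot0r mulr0 dot_ge0.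
  have zz : 0 < dot z z by rewrite dot_gt0.
  have := minF _ (normalize z Bz z0).
  rewrite {2}/F -scalemxAr dotZl dotZr mulrA -expr2 exprVn (sqr_sqrtr (ltW zz)).
  by rewrite mulrC ler_pdivlMr.
exists (F y); split => //.
- rewrite lt_def dot_ge0 andbT dot_eq0; apply/eqP => /By; rewrite y1.
  by move/eqP; rewrite oner_eq0.
- exists y; first by rewrite -dot_gt0 y1.
  (* The first variation of F - F y |.|^2 at y in the direction g is 2 |g|^2. *)
  pose g := B^T *m B *m y - F y *: y.
  have Bg : kerperp B g.
    by rewrite /g -scaleNr -mulmxA; apply: kerperpD => //; exact: kerperp_tr.
  have gE : dot (B *m y) (B *m g) = dot g g + F y * dot y g.
    by rewrite dot_mulmxr mulmxA -dotZl -dotDl /g subrK.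
  apply/eqP; rewrite -subr_eq0 -/g -dot_eq0; apply/eqP.
  clearbody g; apply: (@mulfI _ 2) => //; rewrite mulr0.
  apply: (@linear_coef_eq0 _ (F g - F y * dot g g)) => t.
  have := minV _ (kerperpD t By Bg); rewrite -subr_ge0.
  rewrite [in F (y + _)]/F mulmxDr -scalemxAr !(dotDl, dotDr, dotZl, dotZr).
  rewrite (dotC (B *m g) (B *m y)) gE (dotC g y) y1 -/(F y) -/(F g).
  by move=> H; apply: le_trans H _; rewrite le_eqVlt; apply/orP; left; apply/eqP; ring.
Qed.

End Minimizers.

(** * Singular values of column submatrices *)

Section SingularValues.
Context {R : realType}.

Lemma inf_fin_attained (I : finType) (f : I -> R) (P : set I) : P !=set0 ->
  exists2 i, P i & inf [set f i | i in P] = f i /\ forall j, P j -> f i <= f j.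
Proof.
move=> [i0 Pi0].
have P0 : [pred i | `[<P i>]] i0 by apply/asboolP.
case: (@arg_minP _ _ _ i0 [pred i | `[<P i>]] f P0) => i /asboolP Pi mini; exists i => //.
have lb j : P j -> f i <= f j by move=> Pj; apply: mini; apply/asboolP.
split=> //; apply/eqP; rewrite eq_le; apply/andP; split.
  by apply: ge_inf; [exists (f i) => _ [j Pj <-]; exact: lb | exists i].
by apply: lb_le_inf; [exists (f i), i | move=> _ [j Pj <-]; exact: lb].
Qed.

(** An eigenvector of [B^T B] for [s ^+ 2 > 0] is a multiple of an image under [B^T], hence lies in
    [kerperp B], where the variational bound gives [mu <= s ^+ 2]. *)
Lemma sigma_minE m n (B : 'M[R]_(m, n)) : B != 0 ->
  exists2 mu, 0 < mu & sigma_min B = Num.sqrt mu /\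
    forall y, kerperp B y -> mu * dot y y <= dot (B *m y) (B *m y).
Proof.
move=> /exists_min_singular[mu [mu0 [v v0 Bv] minB]]; exists mu => //; split=> //.
have symB : (B^T *m B)^T = B^T *m B by rewrite trmx_mul trmxK.
rewrite /sigma_min; set S := (X in inf X).
have Smu : S (Num.sqrt mu).
  split; first by rewrite sqrtr_gt0.
  apply/eigenvalueP; exists v^T; last by rewrite trmx_eq0.
  by rewrite sqr_sqrtr ?(ltW mu0) // -[in LHS]symB -trmx_mul Bv linearZ.
have lbS : lbound S (Num.sqrt mu).
  move=> s [s0 /eigenvalueP[w wB w0]].
  have BwT : B^T *m (B *m w^T) = s ^+ 2 *: w^T.
    by rewrite mulmxA -[X in X *m _]symB -trmx_mul wB linearZ.
  have s2 : 0 < s ^+ 2 by rewrite exprn_gt0.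
  have Bw : kerperp B w^T.
    have s2n0 : s ^+ 2 != 0 by rewrite gt_eqF.
    rewrite -[w^T](scalerK s2n0) -BwT.
    by apply: kerperpZ; exact: kerperp_tr.
  have := minB _ Bw; rewrite dot_mulmxl BwT dotZr ler_pM2r; last first.
    by rewrite dot_gt0 trmx_eq0.
  by move=> mus; rewrite -(gtr0_norm s0) -sqrtr_sqr ler_sqrt // ltW.
apply/eqP; rewrite eq_le; apply/andP; split; first by apply: ge_inf => //;
  exists (Num.sqrt mu).
by apply: lb_le_inf => //; exists (Num.sqrt mu).
Qed.

Lemma sigma_min_gt0 m n (B : 'M[R]_(m, n)) : B != 0 -> 0 < sigma_min B.
Proof. by move=> /sigma_minE[mu mu0 [-> _]]; rewrite sqrtr_gt0. Qed.

Lemma sigma_min_le m n (B : 'M[R]_(m, n)) y : B != 0 -> kerperp B y ->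
  sigma_min B ^+ 2 * dot y y <= dot (B *m y) (B *m y).
Proof.
by move=> /sigma_minE[mu mu0 [-> H]] By; rewrite sqr_sqrtr ?(ltW mu0) //; exact: H.
Qed.

Lemma colsubset_setT m n (A : 'M[R]_(m, n)) : A != 0 -> colsubset A [set: 'I_n]%SET != 0.
Proof.
apply: contra_neq => B0; apply/matrixP => i j.
have := congr1 (fun B : 'M[R]_(m, #|[set: 'I_n]%SET|) => B i (enum_rank_in
  (finset.in_setT j) j)) B0.
by rewrite !mxE enum_rankK_in ?finset.in_setT.
Qed.

Lemma sigma_tilde_min_gt0 m n (A : 'M[R]_(m, n)) : A != 0 -> 0 < sigma_tilde_min A.
Proof.
move=> A0; rewrite /sigma_tilde_min.
have [|J AJ [-> _]] := @inf_fin_attained _ (fun J => sigma_min (colsubset A J))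
  [set J | colsubset A J != 0].
  by exists [set: 'I_n]%SET; exact: colsubset_setT.
exact: sigma_min_gt0.
Qed.

Lemma sigma_tilde_min_le m n (A : 'M[R]_(m, n)) J : colsubset A J != 0 ->
  sigma_tilde_min A <= sigma_min (colsubset A J).
Proof.
move=> AJ; apply: ge_inf; last by exists J.
by exists 0 => _ [K AK <-]; apply/ltW/sigma_min_gt0.
Qed.

Lemma sum_enum_val n (J : {set 'I_n}) (F : 'I_n -> R) :
  (forall j, j \notin J -> F j = 0) -> \sum_(k < #|J|) F (enum_val k) = \sum_j F j.
Proof.
move=> FJ; rewrite -(big_enum_val (A := mem J) F) [RHS](bigID (mem J)) /=.
by rewrite [X in _ = _ + X]big1 ?addr0.
Qed.

Lemma colsubset_mul m n (A : 'M[R]_(m, n)) (J : {set 'I_n}) (w : 'cV[R]_n) :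
  (forall j, j \notin J -> w j 0 = 0) ->
  colsubset A J *m (\col_k w (enum_val k) 0) = A *m w.
Proof.
move=> wJ; apply/colP => i; rewrite !mxE.
rewrite -(@sum_enum_val n J (fun j => A i j * w j 0)).
  by apply: eq_bigr => k _; rewrite !mxE.
by move=> j /wJ ->; rewrite mulr0.
Qed.

Lemma dot_colsubset n (J : {set 'I_n}) (w : 'cV[R]_n) :
  (forall j, j \notin J -> w j 0 = 0) ->
  dot (\col_(k < #|J|) w (enum_val k) 0) (\col_k w (enum_val k) 0) = dot w w.
Proof.
move=> wJ; rewrite /dot -(@sum_enum_val n J (fun j => w j 0 * w j 0)).
  by apply: eq_bigr => k _; rewrite !mxE.
by move=> j /wJ ->; rewrite mulr0.
Qed.

(** Let J be the support of [w]. The columns in J are independent, so the submatrix has trivial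
    kernel, its [kerperp] is the whole space, and the bound by its smallest singular value
    applies. *)
Lemma sigma_tilde_min_indep m n (A : 'M[R]_(m, n)) (w : 'cV[R]_n) :
  (forall c : 'cV[R]_n, A *m c = 0 -> (forall j, w j 0 = 0 -> c j 0 = 0) -> c = 0) ->
  sigma_tilde_min A ^+ 2 * dot w w <= dot (A *m w) (A *m w).
Proof.
move=> indep; have [->|w0] := eqVneq w 0; first by rewrite dot0r mulr0 dot_ge0.
pose J := [set j | w j 0 != 0]%SET.
have wJ j : j \notin J -> w j 0 = 0 by rewrite inE negbK => /eqP.
pose y : 'cV[R]_#|J| := \col_k w (enum_val k) 0.
have By : colsubset A J *m y = A *m w by exact: colsubset_mul.
have AJ : colsubset A J != 0.
  apply: contraNneq w0 => B0; apply/eqP; apply: indep => //.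
  by rewrite -By B0 mul0mx.
have kery : kerperp (colsubset A J) y.
  move=> k Bk; suff -> : k = 0 by rewrite dot0l.
  (* Extending [k] by zero outside J makes the independence hypothesis applicable. *)
  pose c : 'cV[R]_n := \col_j if insub j is Some i then k (enum_rank_in (valP (i : {j | j
    \in J})) j) 0 else 0.
  have cJ j : j \notin J -> c j 0 = 0 by move=> jJ; rewrite mxE insubF //; exact: negbTE.
  have ck : (\col_i c (enum_val i) 0) = k.
    apply/colP => i; rewrite !mxE; case: insubP => [[j' jJ] _ /= E|];
      last by rewrite enum_valP.
    by rewrite enum_valK_in.
  rewrite -ck; suff -> : c = 0 by apply/colP => i; rewrite !mxE.
  apply: indep; last by move=> j wj0; apply: cJ; rewrite inE wj0 eqxx.
  by rewrite -(colsubset_mul A cJ) ck.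
rewrite -By -(dot_colsubset wJ); apply: le_trans (sigma_min_le AJ kery).
apply: ler_wpM2r; first exact: dot_ge0.
rewrite lerXn2r ?nnegrE //; last exact: sigma_tilde_min_le.
  by apply: lb_le_inf; [exists (sigma_min (colsubset A J)), J | move=> _ [K AK <-];
    apply/ltW/sigma_min_gt0].
exact/ltW/sigma_min_gt0.
Qed.

End SingularValues.

(** * Existence of a dual solution *)

Section DualSolution.
Context {R : realType}.

(** A difference of two positive parts, from which continuity is evident. *)
Lemma softE (lam : R) (lam_ge0 : 0 <= lam) s :
  soft lam s = Num.max (s - lam) 0 - Num.max (- s - lam) 0.
Proof.
case: (softP lam_ge0) => [ls|ls|l1 l2].
- by rewrite max_l ?max_r; lra.
- by rewrite max_r ?max_l; lra.
- by rewrite !max_r; lra.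
Qed.

Lemma continuous_soft (lam : R) (lam_ge0 : 0 <= lam) : continuous (soft lam : R -> R).
Proof.
rewrite (_ : soft lam = fun s => Num.max (s - lam) 0 - Num.max (- s - lam) 0); last first.
  by apply/funext => s; exact: softE.
have cN : continuous (fun s : R => - s) by move=> s; apply: cvgN; exact: cvg_id.
have cmax (f : R -> R) : continuous f -> continuous (fun s => Num.max (f s - lam) 0).
  move=> cf s; apply: (@continuous_max R R (fun s => f s - lam) (fun=> 0)).
    by apply: cvgB; [exact: cf | exact: cvg_cst].
  exact: cvg_cst.
move=> s; apply: cvgB; last exact: cmax.
by apply: (cmax id) => t; exact: cvg_id.
Qed.

(** Quadratic growth of the dual objective in one coordinate; it comes down to a square,
    [(|s| / 2 - (lam + |x|)) ^+ 2 >= 0]. *)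
Lemma soft_sqr_ge (lam : R) (lam_ge0 : 0 <= lam) s x :
  s ^+ 2 / 4 - (lam + `|x|) ^+ 2 <= soft lam s ^+ 2 / 2 - x * s.
Proof.
have h1 : s ^+ 2 / 2 - lam * `|s| <= soft lam s ^+ 2 / 2.
  have := sqr_ge0 lam; case: (softP lam_ge0) => [ls|ls|l1 l2].
  - by rewrite gtr0_norm; nra.
  - by rewrite ltr0_norm; nra.
  - have : `|s| <= lam by rewrite ler_norml l1.
    have := real_normK (num_real s); have := normr_ge0 s; nra.
have h2 : x * s <= `|x| * `|s| by rewrite -normrM ler_norm.
have := real_normK (num_real s); have := sqr_ge0 (`|s| / 2 - (lam + `|x|)); nra.
Qed.

(** The dual objective is minimised over [v] in the range of [A^T], where its sublevel sets are
    bounded, rather than over [y], which matters only modulo the kernel of [A^T]. *)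
Lemma exists_dual_solution m n (lam : R) (lam_ge0 : 0 <= lam) (A : 'M[R]_(m, n)) (x0 :
  'cV[R]_n) :
  exists y, A *m soft_shrinkage lam (A^T *m y) = A *m x0.
Proof.
pose F (v : 'cV[R]_n) := \sum_j (soft lam (v j 0) ^+ 2 / 2 - x0 j 0 * v j 0).
have FE v : F v = conjugate lam v - dot x0 v by rewrite conjugateE // /dot -sumrB.
have cF : continuous F.
  apply: continuous_sumf => j.
  have cs : continuous (fun v : 'cV[R]_n => soft lam (v j 0)).
    by move=> v; apply: continuous_comp;
      [exact: coord_continuous | exact: continuous_soft].
  have cj : continuous (fun v : 'cV[R]_n => v j 0) by exact: coord_continuous.
  move=> v; apply: (@cvgB _ _ _ _ (nbhs_filter v)); last first.
    by apply: continuousM; [exact: cst_continuous | exact: cj].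
  apply: (@continuousM _ _ (fun v : 'cV[R]_n => soft lam (v j 0) ^+ 2) (fun=> 2^-1)).
    exact: (@continuousM _ _ _ _ v (cs v) (cs v)).
  exact: cst_continuous.
(* As [F 0 = 0], summing [soft_sqr_ge] bounds [dot v v] by this [K] whenever [F v <= F 0]. *)
pose K := 4 * \sum_j (lam + `|x0 j 0|) ^+ 2.
have [||v Av minv] := exists_minimizer (y0 := 0) (M := K + 1) cF (@closed_kerperp _ _ _
  A).
- by move=> k _; rewrite dot0r.
- move=> v _; rewrite {2}/F big1 => [Fv j|j _]; last first.
    rewrite mxE mulr0 subr0.
    have /(soft_eq0 lam_ge0) -> : `|0 : R| <= lam by rewrite normr0.
    by rewrite expr0n mul0r.
  apply: norm_entry_le.
  have : \sum_j (v j 0 ^+ 2 / 4 - (lam + `|x0 j 0|) ^+ 2) <= 0.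
    by apply: le_trans Fv; apply: ler_sum => i _; exact: soft_sqr_ge.
  rewrite sumrB -mulr_suml /K (eq_bigr (fun i => v i 0 * v i 0));
    first by rewrite -/(dot v v); lra.
  by move=> i _; rewrite expr2.
have [y vE] := orthogonal_ker Av; exists y; rewrite -vE.
set e := soft_shrinkage lam v - x0.
suff : dot (A *m e) (A *m e) = 0.
  by move/eqP; rewrite dot_eq0 /e mulmxBr subr_eq0 => /eqP.
(* Moving [v] along [d] changes [F] with linear coefficient [dot e d], the squared norm of [A *m e],
   which must vanish at a minimum. *)
rewrite dot_mulmxl; set d := A^T *m _.
apply: (@linear_coef_eq0 _ _ (dot d d / 2)) => t.
have := minv _ (kerperpD t Av (@kerperp_tr _ _ _ A (A *m e))); rewrite -/d !FE.
have := conjugate_smooth lam_ge0 v (t *: d).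
by rewrite dotDr !(dotZl, dotZr) dotBl (dotC d (soft_shrinkage lam v)); lra.
Qed.

End DualSolution.

(** * Farkas lemma and Caratheodory reduction *)

Section Cones.
Context {R : realType}.

(* Only the closure properties of the cone K are used, which keeps the induction
   free of coefficient families; the step is Bartl's elimination of a along x0. *)
Lemma farkas n (K : 'cV[R]_n -> Prop) :
  K 0 -> (forall u v, K u -> K v -> K (u + v)) ->
  (forall a u, 0 <= a -> K u -> K (a *: u)) ->
  forall (s : seq 'cV[R]_n) b, (forall a, a \in s -> K a) ->
  (forall x, (forall a, a \in s -> dot a x <= 0) -> dot b x <= 0) -> K b.
Proof.
move=> K0 KD KZ s; have [k] := ubnP (size s); elim: k s => // k IHk [|a s] /= sk b Ks Hb.
  have : dot b b <= 0 by apply: Hb.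
  by rewrite le_eqVlt ltNge dot_ge0 orbF dot_eq0 => /eqP ->.
have Kcons c : c \in s -> K c by move=> cs; apply: Ks; rewrite inE cs orbT.
have [bs|] := pselect (forall x, (forall c, c \in s -> dot c x <= 0) -> dot b x <= 0).
  exact: IHk bs.
move=> /existsNP[x0 /not_implyP[sx0 /negP]]; rewrite -ltNge => bx0.
have ax0 : 0 < dot a x0.
  rewrite ltNge; apply/negP => ax0; have : dot b x0 <= 0.
    by apply: Hb => c; rewrite inE => /predU1P[->|/sx0].
  by rewrite leNgt bx0.
have Ka : K a by apply: Ks; rewrite mem_head.
(* The map [f] shifts along [a] onto the hyperplane orthogonal to [x0]. For [c] in [s],
   [dot c x0 <= 0 < dot a x0], so a non-negative multiple of [a] is added and [f c] stays in [K];
   [b] is [f b] plus a positive multiple of [a]. *)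
pose f c := c + (- (dot c x0 / dot a x0)) *: a.
have fE c x : dot (f c) x = dot c (x + (- (dot a x / dot a x0)) *: x0).
  by rewrite /f dotDl dotDr dotZl dotZr; ring.
have bE : b = f b + (dot b x0 / dot a x0) *: a by rewrite /f -addrA -scalerDl addNr
  scale0r addr0.
rewrite bE; apply: (KD); last by apply: (KZ) => //; rewrite divr_ge0 // ltW.
apply: (IHk (map f s)); first by rewrite size_map.
  move=> _ /mapP[c cs ->]; apply: (KD); first exact: Kcons.
  by apply: (KZ) => //; rewrite oppr_ge0 mulr_le0_ge0 ?sx0 // invr_ge0 ltW.
move=> x fx; rewrite fE; apply: Hb => c; rewrite inE => /predU1P[->|cs].
  by rewrite dotDr dotZr mulNr divfK ?subrr // gt_eqF.
by rewrite -fE; apply: fx; exact: map_f.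
Qed.

(** While the support of [w] carries a nonzero kernel vector of [A], subtracting a multiple of it
    annihilates an entry of [w] and preserves [A *m w]; the induction is on the size of the
    support. *)
Lemma caratheodory m n (A : 'M[R]_(m, n)) (w : 'cV[R]_n) :
  exists w', [/\ A *m w' = A *m w,
    forall j, 0 < w' j 0 -> 0 < w j 0, forall j, w' j 0 < 0 -> w j 0 < 0 &
    forall c : 'cV[R]_n, A *m c = 0 -> (forall j, w' j 0 = 0 -> c j 0 = 0) -> c = 0].
Proof.
have [k] := ubnP #|[set j | w j 0 != 0]%SET|; elim: k w => // k IHk w wk.
have [indep|] := pselect (forall c : 'cV[R]_n, A *m c = 0 ->
    (forall j, w j 0 = 0 -> c j 0 = 0) -> c = 0).
  by exists w.
move=> /existsNP[c /not_implyP[Ac /not_implyP[cw c0]]].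
have [j0 cj0] := exists_entry_neq0 (introN eqP c0).
have [j1 /= cj1 [_ minj]] := @inf_fin_attained R _ (fun j => `|w j 0 / c j 0|)
  [set j | c j 0 != 0] (ex_intro _ j0 cj0).
(* |t| is the smallest ratio |w_j / c_j|, so no entry of w - t c changes sign. *)
pose t := w j1 0 / c j1 0; pose w1 := w - t *: c.
have tc j : `|t * c j 0| <= `|w j 0|.
  have [->|cj] := eqVneq (c j 0) 0; first by rewrite mulr0 normr0.
  by have := minj _ cj;
    rewrite /= -/t [X in _ <= X]normf_div ler_pdivlMr ?normr_gt0 // -normrM.
have w1E j : w1 j 0 = w j 0 - t * c j 0 by rewrite !mxE.
have w1j1 : w1 j1 0 = 0 by rewrite w1E /t divfK // subrr.
have w10 j : w j 0 = 0 -> w1 j 0 = 0 by move=> wj; rewrite w1E wj cw // mulr0 subr0.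
have wj1 : w j1 0 != 0 by apply: contra_neq cj1 => /cw.
have [|w' [Aw' w'pos w'neg w'indep]] := IHk w1.
  rewrite ltnS in wk; apply: leq_trans wk.
  apply: proper_card; apply/properP; split.
    by apply/fintype.subsetP => j; rewrite !inE; apply: contra_neq; exact: w10.
  by exists j1; rewrite !inE ?w1j1 ?eqxx.
exists w'; split => //.
- by rewrite Aw' mulmxBr -scalemxAr Ac scaler0 subr0.
- move=> j /w'pos; rewrite w1E; have := tc j;
  case: (ltgtP (w j 0) 0) => [wj|//|/[dup] wj ->].
    by rewrite (ltr0_norm wj); have := ler_norm (- (t * c j 0)); rewrite normrN; lra.
  by rewrite cw // mulr0 subr0 ltxx.
- move=> j /w'neg; rewrite w1E; have := tc j;
  case: (ltgtP (w j 0) 0) => [//|wj|/[dup] wj ->].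
    by rewrite (gtr0_norm wj); have := ler_norm (t * c j 0); lra.
  by rewrite cw // mulr0 subr0 ltxx.
Qed.

Lemma exists_small n (al be : 'I_n -> R) : (forall j, 0 < al j) ->
  exists2 t, 0 < t & forall j, t * `|be j| <= al j.
Proof.
move=> al0; pose S := 1 + \sum_j `|be j| / al j.
have term j : 0 <= `|be j| / al j by rewrite divr_ge0 // ltW.
have S0 : 0 < S by rewrite ltr_wpDr // sumr_ge0.
exists S^-1; first by rewrite invr_gt0.
move=> j; rewrite mulrC ler_pdivrMr // mulrC -ler_pdivrMr //.
rewrite /S (bigD1 j) //= addrCA lerDl addr_ge0 // sumr_ge0 //.
Qed.

End Cones.

(** * Error bound for the Bregman distance *)

Section ErrorBound.
Context {R : realType}.
Variables (lam : R) (m n : nat) (A : 'M[R]_(m, n)).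

(** Here [yhat] is the projection of [y] onto the polyhedron of dual solutions, and [y - yhat] is
    normal to it. To apply Farkas, a direction [d] with non-positive product with every signed
    active column is shown to be feasible, so optimality of [yhat] forces [dot h d <= 0]. *)
Lemma shrinkage_fiber_normal (lam_ge0 : 0 <= lam) (xhat : 'cV[R]_n) (y0 y : 'cV[R]_m) :
  xhat = soft_shrinkage lam (A^T *m y0) ->
  exists yhat w, [/\ xhat = soft_shrinkage lam (A^T *m yhat), y - yhat = A *m w,
    forall j, 0 < w j 0 -> xhat j 0 != 0 \/ (A^T *m yhat) j 0 = lam &
    forall j, w j 0 < 0 -> xhat j 0 != 0 \/ (A^T *m yhat) j 0 = - lam].
Proof.
move=> xhatE.
pose C := [set z | soft_shrinkage lam (A^T *m z) = xhat].
pose F z := dot (y - z) (y - z).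
have clC : closed C.
  rewrite (_ : C = \bigcap_(j in [set: 'I_n])
      ((fun z => soft lam (dot (col j A) z)) @^-1` [set xhat j 0])).
    apply: closed_bigI => j _; apply: preimage_closed; last exact: closed_eq.
    move=> z _; apply: continuous_comp; first exact: continuous_dot.
    exact: continuous_soft.
  apply/seteqP; split=> z; first by move=> /= <- j _ /=; rewrite mxE mulmx_trE.
  by move=> Cz; apply/colP => j; rewrite -Cz // mxE mulmx_trE.
have FE z : F z = dot y y + (dot z z - 2 * dot y z).
  by rewrite /F !(dotBl, dotBr) (dotC z y); ring.
have cF : continuous F.
  rewrite (_ : F = fun z => dot y y + (dot z z - 2 * dot y z)); last exact/funext.
  move=> z; apply: (@cvgD _ _ _ _ (nbhs_filter z)); first exact: cvg_cst.
  apply: (@cvgB _ _ _ _ (nbhs_filter z)); first exact: continuous_dot_sqr.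
  exact: (@continuousM R _ (fun=> 2) (dot y) z (@cst_continuous _ _ _ z) (@continuous_dot
    R m y z)).
have [|yhat Cyhat minF] := exists_minimizer (y0 := y0) (M := F y0 + 1 + (dot y y + 1)) cF
  clC (esym xhatE).
  move=> z _ /norm_entry_le => /(_ _) zj j.
  have := zj j; have := norm_entry_le j (lexx (dot y y)).
  rewrite !mxE => H1 H2; rewrite -(subKr (y j 0) (z j 0)).
  by apply: le_trans (ler_normB _ _) _; rewrite addrC lerD.
set h := y - yhat; set t := A^T *m yhat.
have soft_t j : soft lam (t j 0) = xhat j 0 by rewrite -[xhat](Cyhat : soft_shrinkage _ _
  = _) soft_shrinkageE.
(* The pair [(j, s)] stands for column [j] with sign [(-1) ^+ s]. Both signs are allowed where
   [xhat] is nonzero, since [A^T z] is fixed there; elsewhere only the outward sign at an active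
   bound. *)
pose allowed (p : 'I_n * bool) := (xhat p.1 0 != 0) || (t p.1 0 == (-1) ^+ p.2 * lam).
pose K v := exists w : 'cV[R]_n, [/\ v = A *m w,
    forall j, 0 < w j 0 -> allowed (j, false) & forall j, w j 0 < 0 -> allowed (j, true)].
suff [w [hE wpos wneg]] : K h.
  exists yhat, w; split=> // j.
    by move=> /wpos /orP[|/eqP]; [left | rewrite mul1r; right].
  by move=> /wneg /orP[|/eqP]; [left | rewrite mulN1r; right].
apply: (@farkas _ _ K _ _ _
  [seq (-1) ^+ (p.2 : bool) *: col p.1 A | p : 'I_n * bool <- enum allowed]).
- by exists 0; split=> [|j|j]; rewrite ?mulmx0 // mxE ltxx.
- move=> _ _ [w1 [-> p1 n1]] [w2 [-> p2 n2]]; exists (w1 + w2); split;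
  first by rewrite mulmxDr.
    move=> j; rewrite mxE => w12; have [/p1 //|w1j] := ltP 0 (w1 j 0); apply: p2; lra.
  move=> j; rewrite mxE => w12; have [/n1 //|w1j] := ltP (w1 j 0) 0; apply: n2; lra.
- move=> a _ a0 [w [-> pw nw]]; exists (a *: w); split; first by rewrite scalemxAr.
    by move=> j; rewrite mxE => aw; apply: pw; rewrite ltNge; apply/negP => wj;
      have := mulr_ge0_le0 a0 wj; lra.
  by move=> j; rewrite mxE => aw; apply: nw; rewrite ltNge; apply/negP => wj;
    have := mulr_ge0 a0 wj; lra.
- move=> v /mapP[[j s]]; rewrite mem_enum => al ->.
  exists ((-1) ^+ s *: delta_mx j 0); split; first by rewrite -scalemxAr colE.
    move=> i; rewrite !mxE eqxx andbT; have [->|_] := eqVneq i j;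
      last by rewrite mulr0 ltxx.
    by case: s al => //= _; rewrite mulr1 ltr0N1.
  move=> i; rewrite !mxE eqxx andbT; have [->|_] := eqVneq i j;
    last by rewrite mulr0 ltxx.
  by case: s al => //= _; rewrite mulr1 ltr10.
move=> d Hd; pose e j := dot (col j A) d.
have gen j s : allowed (j, s) -> (-1) ^+ s * e j <= 0.
  move=> al; rewrite -dotZl; apply: Hd.
  by apply/mapP; exists (j, s); rewrite ?mem_enum.
have epos j : allowed (j, false) -> e j <= 0 by move=> /gen; rewrite mul1r.
have eneg j : allowed (j, true) -> 0 <= e j by move=> /gen; rewrite mulN1r oppr_le0.
(* Room for moving coordinate [j]: the slack of an inactive bound, or, at an active bound, where the
   motion is inward, an amount that cannot cross the opposite bound. For [lam = 0] the value 1 is a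
   placeholder, as then [e j = 0]. *)
pose al j := if `|t j 0| < lam then lam - `|t j 0| else if 0 < lam then lam else 1.
have al0 j : 0 < al j by rewrite /al; case: ifP => [|_]; [lra | case: ifP].
have [t1 t10 t1e] := exists_small e al0.
have feas s : 0 < s -> s <= t1 -> C (yhat + s *: d).
  move=> s0 st; apply/colP => j; rewrite soft_shrinkageE mulmxDr -scalemxAr -/t.
  rewrite mxE [X in _ + X]mxE [(A^T *m d) j 0]mulmx_trE -/(e j).
  have se : s * `|e j| <= al j by apply: le_trans (t1e j); apply: ler_wpM2r.
  have [xj|xj] := eqVneq (xhat j 0) 0; last first.
    have -> : e j = 0 by apply/eqP; rewrite eq_le epos ?eneg // /allowed xj.
    by rewrite mulr0 addr0.
  rewrite xj; apply/soft_eq0 => //.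
  have tl : `|t j 0| <= lam by apply/soft_eq0; rewrite // soft_t.
  have nse : `|s * e j| = s * `|e j| by rewrite normrM gtr0_norm.
  move: se; rewrite /al; case: ifP => [_ se|/negbT].
    by apply: le_trans (ler_normD _ _) _; rewrite nse; lra.
  rewrite -leNgt => tl'; have tE : `|t j 0| = lam by apply/eqP; rewrite eq_le tl.
  have [t0|t0] := leP 0 (t j 0).
    have tj : t j 0 = lam by rewrite -tE ger0_norm.
    have e0 : e j <= 0 by apply: epos; rewrite /allowed /= tj mul1r eqxx orbT.
    case: ifP => [l0 se|/negbT].
      by rewrite tj ler_norml; move: se; rewrite -nse ler_norml => /andP[]; nra.
    rewrite -leNgt => l0 _; have l00 : lam = 0 by lra.
    have e00 : 0 <= e j by apply: eneg; rewrite /allowed /= tj l00 mulr0 eqxx orbT.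
    have -> : e j = 0 by lra.
    by rewrite mulr0 addr0.
  have tj : t j 0 = - lam by rewrite -tE ltr0_norm ?opprK.
  have e0 : 0 <= e j by apply: eneg; rewrite /allowed /= tj mulN1r eqxx orbT.
  case: ifP => [l0 se|]; last by lra.
  by rewrite tj ler_norml; move: se; rewrite -nse ler_norml => /andP[]; nra.
rewrite leNgt; apply/negP => hd.
pose D := dot d d + 1; have D0 : 0 < D by rewrite ltr_wpDl // dot_ge0.
(* Moving by [s *: d] changes the squared distance to [y] by [s ^+ 2 * dot d d - 2 * s * dot h d],
   negative for this [s]; the 1 in [D] avoids a zero denominator. *)
pose s := Num.min t1 (dot h d / D).
have s0 : 0 < s by rewrite lt_min t10 divr_gt0.
have st1 : s <= t1 by rewrite ge_min lexx.
have := minF _ (feas s s0 st1).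
have : s * D <= dot h d by rewrite -ler_pdivlMr // ge_min lexx orbT.
rewrite /F opprD addrA -/h /D; clearbody h;
  rewrite !(dotBl, dotBr, dotZl, dotZr) (dotC d h).
by nra.
Qed.

Lemma error_bound (lam_ge0 : 0 <= lam) (c : R) (xhat : 'cV[R]_n) (y0 y : 'cV[R]_m) :
  xhat = soft_shrinkage lam (A^T *m y0) -> 0 <= c -> c <= 1 ->
  (forall j, xhat j 0 != 0 -> c * (`|xhat j 0| + 2 * lam) <= `|xhat j 0|) ->
  forall x, x = soft_shrinkage lam (A^T *m y) ->
  c * sigma_tilde_min A ^+ 2 * bregman lam (A^T *m y) x xhat <=
    dot (A *m x - A *m xhat) (A *m x - A *m xhat).
Proof.
move=> xhatE c0 c1 cx x xE.
have [yhat [w0 [xhatE' hE w0pos w0neg]]] := shrinkage_fiber_normal lam_ge0 y xhatE.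
have [w [wE wpos wneg indep]] := caratheodory A w0.
have sw := sigma_tilde_min_indep indep.
set h := y - yhat in hE; set r := A *m x - A *m xhat.
have hw : h = A *m w by rewrite wE.
rewrite -hw in sw.
set s := A^T *m y; set t := A^T *m yhat.
pose d := A^T *m h.
have dE j : d j 0 = s j 0 - t j 0 by rewrite /d mulmxBr !mxE.
have soft_s j : x j 0 = soft lam (s j 0) by rewrite xE soft_shrinkageE.
have soft_t j : xhat j 0 = soft lam (t j 0) by rewrite [in LHS]xhatE' soft_shrinkageE.
have Dle : bregman lam s x xhat <= dot h r.
  have := bregman_le lam_ge0 xE xhatE'.
  by rewrite -mulmxBr dotC dot_mulmxr trmxK mulmxBr dotC.
have hrE : dot h r = \sum_j (soft lam (s j 0) - soft lam (t j 0)) * d j 0.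
  rewrite /r -mulmxBr dot_mulmxr -/d; apply: eq_bigr => j _.
  by rewrite [(x - xhat) j 0]mxE [(- xhat) j 0]mxE soft_s soft_t mulrC.
(* Only coordinates where [w] and [d] agree in sign are kept: discarding the others can only
   increase [dot w d], and strong monotonicity holds on those kept. *)
pose e j := if 0 < w j 0 * d j 0 then d j 0 else 0.
pose ev : 'cV[R]_n := \col_j e j.
have evE j : ev j 0 = e j by rewrite mxE.
have Gle : c * dot ev ev <= dot h r.
  rewrite hrE /dot mulr_sumr; apply: ler_sum => j _; rewrite evE -expr2 /e.
  case: ifP => [wd|_]; last first.
    by rewrite expr0n mulr0 dE; exact: soft_monotone.
  have [xj|xj] := eqVneq (xhat j 0) 0; last first.
    rewrite dE; apply: soft_strong_monotone => //; last by rewrite -soft_t.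
    by rewrite -soft_t; exact: cx.
  (* At a zero of [xhat] the sign of [w] places [t] at a kink with [d] pointing outward, so [soft]
     has slope 1 there, which is at least [c]. *)
  have d2 : c * d j 0 ^+ 2 <= d j 0 ^+ 2 by rewrite ler_piMl // sqr_ge0.
  rewrite -(soft_t j) xj subr0.
  have [wj|wj] : 0 < w j 0 \/ w j 0 < 0.
    by have [wj|wj|wj] := ltgtP (w j 0) 0; [right|left|move: wd; rewrite wj mul0r ltxx].
  - have dj : 0 < d j 0 by rewrite -(pmulr_rgt0 _ wj).
    have [|tj] := w0pos j (wpos j wj); first by rewrite xj eqxx.
    have -> : s j 0 = lam + d j 0 by rewrite dE /t tj; ring.
    by rewrite soft_pos_boundary // ?ltW // -expr2.
  - have dj : d j 0 < 0 by rewrite -(nmulr_rgt0 _ wj).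
    have [|tj] := w0neg j (wneg j wj); first by rewrite xj eqxx.
    have -> : s j 0 = - lam + d j 0 by rewrite dE /t tj; ring.
    by rewrite soft_neg_boundary // ?ltW // -expr2.
have hh : dot h h <= dot w ev.
  rewrite {2}hw dot_mulmxr -/d dotC; apply: ler_sum => j _.
  by rewrite evE /e; case: ifP => // /negbT; rewrite -leNgt mulr0.
have [h0|h0] := eqVneq h 0.
  apply: le_trans (dot_ge0 r).
  have : bregman lam s x xhat <= 0 by apply: le_trans Dle _; rewrite h0 dot0l.
  by move=> D0; rewrite mulr_ge0_le0 // mulr_ge0 // sqr_ge0.
have hh0 : 0 < dot h h by rewrite dot_gt0.
have CS1 := dot_CauchySchwarz w ev; have CS2 := dot_CauchySchwarz h r.
set S := sigma_tilde_min A ^+ 2 in sw *; have S0 : 0 <= S by rewrite sqr_ge0.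
have hr0 : 0 <= dot h r by apply: le_trans Gle; rewrite mulr_ge0 // dot_ge0.
have rr0 := dot_ge0 r; have ee0 := dot_ge0 ev.
(* Cauchy-Schwarz gives [|h|^4 <= |w|^2 |ev|^2]; [sw] eliminates [w], and one factor [|h|^2]
   cancels. *)
have key1 : S * dot h h <= dot ev ev.
  rewrite -(ler_pM2l hh0);
    have h2 : dot h h ^+ 2 <= dot w ev ^+ 2 by rewrite ler_sqr ?nnegrE //; lra.
  have := ler_wpM2l S0 (le_trans h2 CS1); have := ler_wpM2r ee0 sw; lra.
have key2 : c * S * dot h h <= dot h r by have := ler_wpM2l c0 key1; lra.
have cS0 : 0 <= c * S by rewrite mulr_ge0.
apply: le_trans (ler_wpM2l cS0 Dle) _.
have [->|hr] := eqVneq (dot h r) 0; first by rewrite mulr0.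
have hrp : 0 < dot h r by rewrite lt_def hr.
(* Cauchy-Schwarz for [h] and [r], with [key2] bounding [|h|^2], gives the inequality multiplied by
   [dot h r]. *)
rewrite -(ler_pM2l hrp).
have := ler_wpM2l cS0 CS2; have := ler_wpM2r rr0 key2; lra.
Qed.

End ErrorBound.

(** * Chebyshev's sum inequality for powers of the entries *)

Section NormQuotient.
Context {R : realType}.

Lemma lpnorm_p_gt0 (p : R) n (v : 'cV[R]_n) : v != 0 -> 0 < lpnorm_p p v.
Proof.
move=> /exists_entry_neq0[j vj].
rewrite /lpnorm_p (bigD1 j) //= ltr_wpDr ?powR_gt0 ?normr_gt0 //.
by apply: sumr_ge0 => i _; exact: powR_ge0.
Qed.

Lemma powRD2 (p a : R) : 0 < p -> 0 <= a -> a `^ (p + 2) = a `^ p * a ^+ 2.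
Proof.
move=> p0 a0; rewrite powRD; last by rewrite gt_eqF // ltr_wpDr.
by rewrite powR_mulrn.
Qed.

Lemma lpnorm_pD2 (p : R) n (v : 'cV[R]_n) : 0 < p ->
  lpnorm_p (p + 2) v = \sum_i `|v i 0| `^ p * v i 0 ^+ 2.
Proof.
by move=> p0; apply: eq_bigr => i _; rewrite powRD2 // real_normK ?num_real.
Qed.

(** For similarly ordered [f] and [g] every term on the left is non-negative, which yields both
    Chebyshev's inequality and its equality case. *)
Lemma chebyshev_sum_identity n (f g : 'I_n -> R) :
  \sum_i \sum_j (f i - f j) * (g i - g j) =
  2 * (n%:R * (\sum_i f i * g i) - (\sum_i f i) * (\sum_i g i)).
Proof.
have -> : \sum_i \sum_j (f i - f j) * (g i - g j) =
    \sum_(i < n) (n%:R * (f i * g i) + (\sum_i f i * g i) - f i * \sum_i g i - g i *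
      \sum_i f i).
  apply: eq_bigr => i _; rewrite !mulr_sumr.
  rewrite -[n%:R * _](_ : \sum_(j < n) f i * g i = _); last first.
    by rewrite sumr_const card_ord mulr_natl.
  rewrite -big_split -!sumrB; apply: eq_bigr => j _ /=; ring.
rewrite !sumrB big_split /= -mulr_sumr -!mulr_suml sumr_const card_ord -mulr_natl; ring.
Qed.

Lemma powR_sqr_monotone (p a b : R) : 0 < p -> 0 <= (`|a| `^ p - `|b| `^ p) * (a ^+ 2 - b
  ^+ 2).
Proof.
move=> p0; rewrite -(real_normK (num_real a)) -(real_normK (num_real b)).
have homo x y : 0 <= x -> x <= y -> x `^ p <= y `^ p /\ x ^+ 2 <= y ^+ 2.
  by move=> x0 xy; split; [rewrite ge0_ler_powR ?nnegrE //;
    lra | rewrite ler_sqr ?nnegrE //; lra].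
have [ab|/ltW ab] := leP `|a| `|b|; have [H1 H2] := homo _ _ (normr_ge0 _) ab.
  by apply: mulr_le0; rewrite subr_le0.
by apply: mulr_ge0; rewrite subr_ge0.
Qed.

Lemma lpnorm_chebyshev (p : R) n (v : 'cV[R]_n) : 0 < p ->
  lpnorm_p p v * l2norm v ^+ 2 <= n%:R * lpnorm_p (p + 2) v.
Proof.
move=> p0; have := chebyshev_sum_identity (fun i => `|v i 0| `^ p) (fun i => v i 0 ^+ 2).
rewrite -lpnorm_pD2 // -/(lpnorm_p p v) => E.
have : 0 <= \sum_i \sum_j (`|v i 0| `^ p - `|v j 0| `^ p) * (v i 0 ^+ 2 - v j 0 ^+ 2).
  by apply: sumr_ge0 => i _; apply: sumr_ge0 => j _; exact: powR_sqr_monotone.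
rewrite E l2norm_sqr /dot (eq_bigr (fun i => v i 0 * v i 0)); first by lra.
by move=> i _; rewrite expr2.
Qed.

(** Equality makes every term of the double sum vanish; both factors are differences of strictly
    increasing functions of the modulus, so the moduli agree. *)
Lemma lpnorm_chebyshev_eq (p : R) n (v : 'cV[R]_n) : 0 < p ->
  (lpnorm_p p v * l2norm v ^+ 2 = n%:R * lpnorm_p (p + 2) v <->
   forall i j, `|v i 0| = `|v j 0|).
Proof.
move=> p0; have := chebyshev_sum_identity (fun i => `|v i 0| `^ p) (fun i => v i 0 ^+ 2).
rewrite -lpnorm_pD2 // -/(lpnorm_p p v).
rewrite [\sum_i v i 0 ^+ 2](_ : _ = l2norm v ^+ 2); last first.
  by rewrite l2norm_sqr; apply: eq_bigr => i _; rewrite expr2.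
move=> E; split=> [H|H].
  have ge0 i j : 0 <= (`|v i 0| `^ p - `|v j 0| `^ p) * (v i 0 ^+ 2 - v j 0 ^+ 2).
    exact: powR_sqr_monotone.
  have E0 : \sum_i \sum_j (`|v i 0| `^ p - `|v j 0| `^ p) * (v i 0 ^+ 2 - v j 0 ^+ 2) = 0.
    by rewrite E H subrr mulr0.
  move=> i j.
  have Ei : \sum_j (`|v i 0| `^ p - `|v j 0| `^ p) * (v i 0 ^+ 2 - v j 0 ^+ 2) = 0.
    by apply: (psumr_eq0P _ E0) => // k _; apply: sumr_ge0.
  have /eqP : (`|v i 0| `^ p - `|v j 0| `^ p) * (v i 0 ^+ 2 - v j 0 ^+ 2) = 0.
    by apply: (psumr_eq0P _ Ei).
  rewrite mulf_eq0 !subr_eq0 => /orP[/eqP ij|]; last first.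
    rewrite -(real_normK (num_real (v i 0))) -(real_normK (num_real (v j 0))).
    by rewrite eqrXn2 // => /eqP.
  have pn0 : p != 0 by rewrite gt_eqF.
  by rewrite -[LHS]powRr1 // -[RHS]powRr1 // -(mulfV pn0) !powRrM ij.
apply/esym/eqP; rewrite -subr_eq0; apply/eqP/(@mulfI _ 2) => //.
rewrite -E mulr0; apply: big1 => i _; apply: big1 => j _.
by rewrite (H i j) subrr mul0r.
Qed.

End NormQuotient.

(** * Bounds on the norm quotient and the convergence factor *)

Section Factor.
Context {R : realType}.
Variables (m n : nat) (A : 'M[R]_(m, n)).

Lemma norm_quotient_ge (p : R) (z : 'cV[R]_n) : 0 < p -> A *m z != 0 ->
  m%:R^-1 <= norm_quotient p A z.
Proof.
move=> p0 Az0; have [i _] := exists_entry_neq0 Az0.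
have m0 : 0 < m%:R :> R by rewrite ltr0n (leq_ltn_trans _ (ltn_ord i)).
rewrite /norm_quotient ler_pdivlMr; last first.
  by rewrite mulr_gt0 ?lpnorm_p_gt0 // l2norm_sqr dot_gt0.
by rewrite mulrC ler_pdivrMr // [leRHS]mulrC lpnorm_chebyshev.
Qed.

(** A unit vector here has all entries of modulus 1, matching the equality case of Chebyshev's
    inequality; [u] is [A *m z] divided by the common modulus. *)
Lemma norm_quotient_eq (p : R) (z : 'cV[R]_n) : 0 < p -> A *m z != 0 ->
  (norm_quotient p A z = m%:R^-1 <->
   exists (c : R) (u : 'cV[R]_m), (forall j, `|u j 0| = 1) /\ A *m z = c *: u).
Proof.
move=> p0 Az0; have [i vi] := exists_entry_neq0 Az0.
have m0 : m%:R != 0 :> R by rewrite pnatr_eq0 -lt0n (leq_ltn_trans _ (ltn_ord i)).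
have d0 : lpnorm_p p (A *m z) * l2norm (A *m z) ^+ 2 != 0.
  by rewrite mulf_neq0 ?gt_eqF ?lpnorm_p_gt0 // l2norm_sqr dot_gt0.
have -> : norm_quotient p A z = m%:R^-1 <->
    lpnorm_p p (A *m z) * l2norm (A *m z) ^+ 2 = m%:R * lpnorm_p (p + 2) (A *m z).
  split=> [/(congr1 ( *%R^~ (lpnorm_p p (A *m z) * l2norm (A *m z) ^+ 2)))|H].
    by rewrite /norm_quotient divfK // => ->; rewrite mulrA divff // mul1r.
  by rewrite /norm_quotient H invfM mulrCA divff ?mulr1 //; apply: contraNneq d0 => L;
    rewrite H L mulr0.
rewrite lpnorm_chebyshev_eq //; split=> [H|[c [u [u1 ->]]] j k]; last first.
  by rewrite !mxE !normrM !u1.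
have c0 : `|(A *m z) i 0| != 0 by rewrite normr_eq0.
exists `|(A *m z) i 0|, (`|(A *m z) i 0|^-1 *: (A *m z)); split.
  by move=> j; rewrite mxE normrM normfV normr_id (H j i) mulVf.
by rewrite scalerA divff // scale1r.
Qed.

Lemma norm_quotient_inf_ge (p : R) : 0 < p -> A != 0 ->
  m%:R^-1 <= norm_quotient_inf p A.
Proof.
move=> p0 A0; apply: lb_le_inf; last by move=> _ [z [_ Az0] <-]; exact: norm_quotient_ge.
have [j Aj] := exists_col_neq0 A0.
exists (norm_quotient p A (delta_mx j 0)), (delta_mx j 0) => //; split;
  last by rewrite -colE.
by apply: contraNneq Aj => dj; rewrite colE dj mulmx0.
Qed.

Lemma norm_quotient_inf_le (p : R) (z : 'cV[R]_n) : 0 < p -> A *m z != 0 ->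
  norm_quotient_inf p A <= norm_quotient p A z.
Proof.
move=> p0 Az0; apply: ge_inf.
  by exists m%:R^-1 => _ [y [_ Ay0] <-]; exact: norm_quotient_ge.
exists z => //; split=> //.
by apply: contraNneq Az0 => ->; rewrite mulmx0.
Qed.

Lemma absminP (x : 'cV[R]_n) : x != 0 ->
  0 < absmin x /\ forall j, x j 0 != 0 -> absmin x <= `|x j 0|.
Proof.
move=> x0; rewrite /absmin; have [j0 xj0] := exists_entry_neq0 x0.
have [|j /= xj [-> H]] := @inf_fin_attained R _ (fun j => `|x j 0|) [set j | x j 0 != 0].
  by exists j0.
by split=> //; rewrite normr_gt0.
Qed.

(** Test both factors on the basis vector of a nonzero column. The first is at most the squared norm
    of the column; the second is at most its inverse, because entries of normalized rows have
    modulus at most 1. *)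
Lemma sigma_tilde_quotient_le1 (p : R) : 0 < p -> A != 0 ->
  (forall i, l2norm (arow A i) = 1) ->
  sigma_tilde_min A ^+ 2 * norm_quotient_inf p A <= 1.
Proof.
move=> p0 A0 An.
have [j Aj] := exists_col_neq0 A0.
have dj : A *m delta_mx j 0 = col j A by rewrite colE.
have s2 : sigma_tilde_min A ^+ 2 <= dot (col j A) (col j A).
  have := @sigma_tilde_min_indep _ _ _ A (delta_mx j 0).
  have -> : dot (delta_mx j 0) (delta_mx j 0 : 'cV[R]_n) = 1.
    rewrite /dot (bigD1 j) //= !mxE !eqxx mulr1 big1 ?addr0 // => i ij.
    by rewrite !mxE (negbTE ij) mul0r.
  rewrite mulr1 dj; apply=> c Ac cj.
  have cE : c = c j 0 *: delta_mx j 0.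
    apply/colP => i; rewrite !mxE eqxx andbT; have [->|ij] := eqVneq i j;
      first by rewrite mulr1.
    by rewrite mulr0; apply: cj; rewrite mxE (negbTE ij).
  move: Ac; rewrite cE -scalemxAr dj => /eqP;
    rewrite scaler_eq0 (negbTE Aj) orbF => /eqP ->.
  by rewrite scale0r.
have Q0 : 0 <= norm_quotient_inf p A.
  by apply: le_trans (norm_quotient_inf_ge p0 A0); rewrite invr_ge0 ler0n.
have Qj : norm_quotient_inf p A <= (dot (col j A) (col j A))^-1.
  apply: le_trans (norm_quotient_inf_le p0 (_ : A *m delta_mx j 0 != 0)) _;
    first by rewrite dj.
  rewrite /norm_quotient dj l2norm_sqr invfM mulrA ler_piMl //.
    by rewrite invr_ge0 dot_ge0.
  rewrite ler_pdivrMr ?lpnorm_p_gt0 // mul1r lpnorm_pD2 //; apply: ler_sum => i _.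
  rewrite -[leRHS]mulr1; apply: ler_wpM2l; first exact: powR_ge0.
  have := sqr_entry_le (arow A i) j; rewrite -l2norm_sqr An expr1n !mxE.
  by [].
apply: le_trans (ler_wpM2r Q0 s2) _.
by rewrite -ler_pdivlMl ?mulr1 // dot_gt0.
Qed.

(** The subtracted term is half of a product in [(0, 1]], so the factor lies in [[1/2, 1)]. *)
Lemma wrask_factor_bounds (lam p : R) (xhat : 'cV[R]_n) : 0 <= lam -> 0 < p ->
  A != 0 -> xhat != 0 -> (forall i, l2norm (arow A i) = 1) ->
  0 < wrask_factor lam p A xhat < 1 /\ wrask_factor lam p A xhat <= rask_factor lam A
    xhat.
Proof.
move=> lam0 p0 A0 x0 An; have [mu0 _] := absminP x0.
rewrite /wrask_factor /rask_factor.
have Qge := norm_quotient_inf_ge p0 A0.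
have SQ := sigma_tilde_quotient_le1 p0 A0 An.
have S0 : 0 < sigma_tilde_min A ^+ 2 by rewrite exprn_gt0 // sigma_tilde_min_gt0.
have [i _] : exists i : 'I_m, True.
  case: m A A0 => [B|k _ _]; last by exists ord0.
  by rewrite flatmx0 eqxx.
have m0 : 0 < m%:R^-1 :> R by rewrite invr_gt0 ltr0n (leq_ltn_trans _ (ltn_ord i)).
set c := absmin xhat / _.
have c0 : 0 < c by rewrite divr_gt0 //; lra.
have c1 : c <= 1 by rewrite ler_pdivrMr; lra.
set S := sigma_tilde_min A ^+ 2 in S0 SQ *; set Q := norm_quotient_inf p A in Qge SQ *.
have Q0 : 0 < Q by apply: lt_le_trans Qge.
have SQ0 : 0 < S * Q by rewrite mulr_gt0.
have cSQ0 : 0 < c * (S * Q) by rewrite mulr_gt0.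
have cSQ : c * (S * Q) <= S * Q by rewrite ler_piMl // ltW.
split; first by apply/andP; split; lra.
have : c * (S * m%:R^-1) <= c * (S * Q) by rewrite !ler_pM2l.
lra.
Qed.

End Factor.

(** * Effect of a single step *)

Section Step.
Context {R : realType}.
Variables (lam p : R) (m n : nat) (A : 'M[R]_(m, n)) (b : 'cV[R]_m).

(** The vector [y] is a Lagrange multiplier: [A^T *m y] is orthogonal to differences of feasible
    points, so [bregman_ge] becomes quadratic growth of the objective around [xhat]. *)
Lemma unique_bp_solution (lam_ge0 : 0 <= lam) (xhat : 'cV[R]_n) (y : 'cV[R]_m) :
  xhat = soft_shrinkage lam (A^T *m y) -> A *m xhat = b ->
  unique (bp_solution lam A b) xhat.
Proof.
move=> xhatE Ax.
have H z : A *m z = b -> objective lam xhat + dot (z - xhat) (z - xhat) / 2 <= objective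
  lam z.
  move=> Az; have := bregman_ge lam_ge0 z xhatE.
  by rewrite /bregman dot_mulmxl trmxK mulmxBr Az Ax subrr dot0r; lra.
split; first by split=> // z /H; have := dot_ge0 (z - xhat); lra.
move=> z [Az minz]; apply/eqP; rewrite eq_sym -subr_eq0 -dot_eq0 eq_le dot_ge0 andbT.
by have := H _ Az; have := minz _ Ax; lra.
Qed.

(** The inexact step minimises the quadratic upper model given by smoothness; the exact step
    minimises the dual objective itself along the same line, so it gains at least as much. *)
Lemma bregman_descent (lam_ge0 : 0 <= lam) r (x xs xhat : 'cV[R]_n) j t :
  x = soft_shrinkage lam xs -> A *m xhat = b -> l2norm (arow A j) = 1 ->
  is_step lam r A b x xs j t ->
  bregman lam (xs - t *: arow A j) (soft_shrinkage lam (xs - t *: arow A j)) xhat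
    <= bregman lam xs x xhat - (dot (arow A j) x - b j 0) ^+ 2 / 2.
Proof.
move=> xE Axhat a1 step.
set t0 := dot (arow A j) x - b j 0.
(* Up to a constant the new distance is the objective minimised by the exact step. *)
have H s : bregman lam (xs - s *: arow A j) (soft_shrinkage lam (xs - s *: arow A j))
  xhat =
    objective lam xhat - dot xs xhat + (conjugate lam (xs - s *: arow A j) + s * b j 0).
  by rewrite (bregmanE lam_ge0 _ erefl) dotBl dotZl dot_arow Axhat; lra.
suff : bregman lam (xs - t0 *: arow A j) (soft_shrinkage lam (xs - t0 *: arow A j)) xhat
  <=
    bregman lam xs x xhat - t0 ^+ 2 / 2.
  apply: le_trans; case: r step => /= [->//|/(_ t0)].
  by rewrite !H; lra.
rewrite H (bregmanE lam_ge0 _ xE).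
have := conjugate_smooth lam_ge0 xs (- t0 *: arow A j).
rewrite -xE scaleNr !(dotNl, dotNr, dotZl, dotZr) -l2norm_sqr a1 expr1n.
by rewrite (_ : dot (arow A j) x = t0 + b j 0) ?/t0 ?subrK //; lra.
Qed.

(** Under this law the mean squared residual entry is [norm_quotient p A z] times [|A z|^2] at
    [z = x - xhat]. *)
Lemma mean_descent (p_gt0 : 0 < p) (xhat x : 'cV[R]_n) (D : R) :
  A *m xhat = b -> A *m x <> b -> 0 <= D ->
  \sum_j wrask_prob p A b x j * (D - (dot (arow A j) x - b j 0) ^+ 2 / 2)
    <= D - norm_quotient_inf p A * dot (A *m x - b) (A *m x - b) / 2.
Proof.
move=> Axhat Axb D0; set r := A *m x - b.
have r0 : r != 0 by rewrite subr_eq0; exact/eqP.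
have rE j : dot (arow A j) x - b j 0 = r j 0 by rewrite dot_arow !mxE.
have L0 := lpnorm_p_gt0 p r0.
have sum1 : \sum_j wrask_prob p A b x j = 1.
  rewrite /wrask_prob -mulr_suml -/r (eq_bigr (fun j => `|r j 0| `^ p)).
    by rewrite mulfV // gt_eqF.
  by move=> j _; rewrite rE.
have sum2 : \sum_j wrask_prob p A b x j * (r j 0 ^+ 2) =
    lpnorm_p (p + 2) r / lpnorm_p p r.
  rewrite lpnorm_pD2 // mulr_suml; apply: eq_bigr => j _.
  by rewrite /wrask_prob rE -/r mulrAC.
have rz : r = A *m (x - xhat) by rewrite mulmxBr Axhat.
have Q : norm_quotient_inf p A * dot r r <= lpnorm_p (p + 2) r / lpnorm_p p r.
  have Az0 : A *m (x - xhat) != 0 by rewrite -rz.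
  have := norm_quotient_inf_le p_gt0 Az0; rewrite /norm_quotient -rz l2norm_sqr.
  rewrite invfM mulrA ler_pdivlMr //; first by rewrite dot_gt0.
rewrite (eq_bigr (fun j => wrask_prob p A b x j * D - wrask_prob p A b x j * r j 0 ^+ 2 /
  2)).
  by rewrite sumrB -mulr_suml sum1 -mulr_suml sum2; lra.
by move=> j _; rewrite rE; lra.
Qed.

End Step.

(** * Expectation through a finite-valued random variable *)

Section FiniteExpectation.
Context {R : realType} {d : measure_display} {T : measurableType d}.
Variables (P : probability T R) (I : finType) (h : T -> I).
Hypothesis mh : forall s, measurable (h @^-1` [set s]).

Definition pmf s : R := fine (P (h @^-1` [set s])).

Lemma pmfE s : (pmf s)%:E = P (h @^-1` [set s]).
Proof. by rewrite /pmf fineK // fin_num_measure. Qed.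

Lemma pmf_ge0 s : 0 <= pmf s.
Proof. by rewrite -lee_fin pmfE. Qed.

Lemma pmf_eq0 s : (forall w, h w <> s) -> pmf s = 0.
Proof.
move=> hs; rewrite /pmf (_ : h @^-1` [set s] = set0) ?measure0 //.
by apply/seteqP; split=> w //= /hs.
Qed.

Lemma expectation_fin_comp (g : I -> R) : (forall s, 0 <= g s) ->
  ('E_P[g \o h] = (\sum_s g s * pmf s)%R%:E)%E.
Proof.
move=> g0; rewrite unlock.
transitivity (\int[P]_w \sum_(s <- enum I) (g s * \1_(h @^-1` [set s]) w)%:E)%E.
  apply: eq_integral => w _; rewrite sumEFin big_enum /=; congr (_%:E).
  rewrite (bigD1 (h w)) //= big1 ?addr0 => [|s sw].
    by rewrite indicE mem_set // mulr1.
  by rewrite indicE memNset ?mulr0 //= => hws; rewrite hws eqxx in sw.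
rewrite ge0_integral_sum //; first last.
- by move=> s w _; rewrite lee_fin mulr_ge0.
- by move=> s; apply/measurable_EFinP/measurable_funM;
  [exact: measurable_cst | exact: measurable_indic].
rewrite -sumEFin big_enum; apply: eq_bigr => s _.
under eq_integral do rewrite EFinM.
rewrite ge0_integralZl_EFin //; last by apply/measurable_EFinP; exact: measurable_indic.
by rewrite integral_indic // setIT EFinM pmfE.
Qed.

Lemma sum_pmf : \sum_s pmf s = 1.
Proof.
have := @expectation_fin_comp (fun=> 1) (fun=> ler01).
rewrite (_ : _ \o _ = cst 1) // expectation_cst => -[E]; rewrite [RHS]E.
by apply: eq_bigr => s _; rewrite mul1r.
Qed.

(** Factoring through [h] turns the expectation into a finite sum; measurability of [X] need not be
    assumed. *)
Lemma expectation_factor (X : T -> R) : (forall w, 0 <= X w) ->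
  (forall w w', h w = h w' -> X w = X w') ->
  exists g : I -> R, [/\ forall s, 0 <= g s, forall w, X w = g (h w) &
    ('E_P[X] = (\sum_s g s * pmf s)%R%:E)%E].
Proof.
move=> X0 Xh.
have /choice[g gP] : forall s, exists r : R, 0 <= r /\ forall w, h w = s -> X w = r.
  move=> s; have [[w hw]|H] := pselect (exists w, h w = s).
    by exists (X w); split=> // w' hw'; apply: Xh; rewrite hw'.
  (* Values never taken by [h] receive 0; their mass is 0. *)
  by exists 0; split=> // w hw; case: H; exists w.
have XE w : X w = g (h w) by apply: (gP _).2.
have g0 s : 0 <= g s by case: (gP s).
exists g; split=> //.
by rewrite -expectation_fin_comp //; congr ('E_P[_])%E; exact/funext.
Qed.

End FiniteExpectation.

(** * The random process and its expected decrease *)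

Section Process.
Context {R : realType}.
Variables (lam p : R) (m n : nat) (A : 'M[R]_(m, n)) (b : 'cV[R]_m) (r : step_rule).
Context {d : measure_display} {T : measurableType d}.
Variables (P : probability T R) (i : nat -> T -> 'I_m) (x xs : nat -> T -> 'cV[R]_n).

(** The history takes values in a finite type and its fibres are the sets [same_past], so
    conditioning on it becomes a finite sum. *)
Definition past k w : {ffun 'I_k -> 'I_m} := [ffun l => i (l : 'I_k) w].

Lemma past_fiber k w : past k @^-1` [set past k w] = same_past i k w.
Proof.
apply/seteqP; split=> w' /=.
  by move=> /ffunP E l lk; have := E (Ordinal lk); rewrite !ffunE.
by move=> E; apply/ffunP => l; rewrite !ffunE E.
Qed.

Lemma past_next_eq k w w' : (past k w, i k w) = (past k w', i k w') ->
  same_past i k.+1 w' w.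
Proof.
move=> [/ffunP E ik] l; rewrite ltnS leq_eqVlt => /predU1P[->//|lk].
by have := E (Ordinal lk); rewrite !ffunE.
Qed.

Section Wrask.
Hypothesis W : wrask lam r p A b P i x xs.

Lemma measurable_past k s : measurable (past k @^-1` [set s]).
Proof.
rewrite (_ : _ @^-1` _ = \bigcap_(l in [set: 'I_k]) [set w | i l w = s l]).
  by apply: fin_bigcap_measurable => // l _; exact: (wrask_meas W).
apply/seteqP; split=> w /=; first by move=> <- l _ /=; rewrite ffunE.
by move=> E; apply/ffunP => l; rewrite ffunE; exact: E.
Qed.

Lemma past_next_fiber k s j :
  (fun w => (past k w, i k w)) @^-1` [set (s, j)] = past k @^-1` [set s] `&` [set w | i k
    w = j].
Proof. by apply/seteqP; split=> w /= [-> ->]. Qed.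

Lemma measurable_past_next k sj : measurable ((fun w => (past k w, i k w)) @^-1` [set
  sj]).
Proof.
case: sj => s j; rewrite past_next_fiber; apply: measurableI;
  first exact: measurable_past.
exact: (wrask_meas W).
Qed.

Lemma wrask_shrinkage k w : x k w = soft_shrinkage lam (xs k w).
Proof.
elim: k => [|k IHk].
  have [-> ->] := wrask_init W w; apply/colP => j; rewrite !mxE sgr0 mulr0 //.
have [Ax|Ax] := pselect (A *m x k w = b).
  by have [-> ->] := wrask_stop W Ax.
by have [_ ->] := wrask_step W Ax.
Qed.

Lemma wrask_dual_range k w : exists y, xs k w = A^T *m y.
Proof.
elim: k => [|k [y IHk]].
  by have [_ ->] := wrask_init W w; exists 0; rewrite mulmx0.
have [Ax|Ax] := pselect (A *m x k w = b).
  by have [_ ->] := wrask_stop W Ax; exists y.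
have [[t _ ->] _] := wrask_step W Ax.
exists (y - t *: delta_mx (i k w) 0).
by rewrite mulmxBr -scalemxAr -colE IHk /arow tr_row.
Qed.

Variables (xhat : 'cV[R]_n).
Let D k w := bregman lam (xs k w) (x k w) xhat.

Lemma wrask_bregman_past k w w' : same_past i k w w' -> D k w' = D k w.
Proof. by move=> /(wrask_past W) E; rewrite /D !wrask_shrinkage E. Qed.

Lemma wrask_bregman_ge0 (lam_ge0 : 0 <= lam) k w : 0 <= D k w.
Proof.
apply: le_trans (bregman_ge lam_ge0 _ (wrask_shrinkage k w)).
by rewrite divr_ge0 ?dot_ge0.
Qed.

Lemma wrask_iterate_past k w w' : same_past i k w w' -> x k w' = x k w.
Proof. by move=> /(wrask_past W) E; rewrite !wrask_shrinkage E. Qed.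

Lemma past_eq_same_past k w w' : past k w = past k w' -> same_past i k w' w.
Proof. by rewrite -past_fiber. Qed.

Lemma wrask_bregman_step (lam_ge0 : 0 <= lam) k w :
  A *m xhat = b -> (forall j, l2norm (arow A j) = 1) -> A *m x k w <> b ->
  D k.+1 w <= D k w - (dot (arow A (i k w)) (x k w) - b (i k w) 0) ^+ 2 / 2.
Proof.
move=> Axhat An Ax; have [[t step xsE] xE] := wrask_step W Ax.
rewrite /D xE xsE; exact: bregman_descent (wrask_shrinkage k w) Axhat (An _) step.
Qed.

(** One expectation is a sum over pasts, the other over pairs of a past and a next index; they are
    compared past by past. The constant [c] comes from the error bound. *)
Lemma wrask_expectation_step (lam_ge0 : 0 <= lam) (p_gt0 : 0 < p) (q c : R) k :
  A *m xhat = b -> (forall j, l2norm (arow A j) = 1) ->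
  0 < c -> (forall w, D k w <= c * dot (A *m x k w - b) (A *m x k w - b)) ->
  q = 1 - norm_quotient_inf p A / c / 2 -> 0 <= norm_quotient_inf p A ->
  ('E_P[D k.+1] <= q%:E * 'E_P[D k])%E.
Proof.
move=> Axhat An c0 Dc qE Q0.
have D0 := wrask_bregman_ge0 lam_ge0.
have [|g [g0 gE ->]] := expectation_factor P (@measurable_past k) (D0 k).
  by move=> w w' /past_eq_same_past; exact: wrask_bregman_past.
have [|g' [g'0 g'E ->]] := expectation_factor P (@measurable_past_next k) (D0 k.+1).
  by move=> w w' /past_next_eq; exact: wrask_bregman_past.
rewrite -EFinM lee_fin.
rewrite (eq_bigr (fun sj => g' (sj.1, sj.2) * pmf P (fun w => (past k w, i k w)) (sj.1,
  sj.2))); last first.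
  by case.
rewrite -(pair_bigA _ (fun s j => g' (s, j) * pmf P (fun w => (past k w, i k w)) (s, j)))
  /=.
rewrite mulr_sumr; apply: ler_sum => s _.
have [[w <-]|ns] := pselect (exists w, past k w = s); last first.
  rewrite [pmf P _ s]pmf_eq0 ?mulr0; last by move=> w ws; apply: ns; exists w.
  rewrite big1 // => j _; rewrite pmf_eq0 ?mulr0 // => w [ws _].
  by apply: ns; exists w.
rewrite -gE.
have [Ax|Ax] := pselect (A *m x k w = b).
  (* On a stopped past [Dc] forces the distance to be 0, and it remains 0. *)
  have Dw : D k w = 0.
    by apply/eqP; rewrite eq_le D0 andbT; have := Dc w; rewrite Ax subrr dot0r mulr0.
  rewrite Dw mul0r mulr0 big1 // => j _.
  have [[w' [ww' ij]]|nw] := pselect (exists w', past k w' = past k w /\ i k w' = j);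
    last first.
    by rewrite pmf_eq0 ?mulr0 // => w' [ww' ij]; apply: nw; exists w'.
  have sp := past_eq_same_past ww'.
  rewrite -ww' -ij -g'E /D; have := wrask_iterate_past sp.
  move=> xw; have [] := @wrask_stop _ _ _ _ _ _ _ _ _ _ _ _ _ _ W k w';
    first by rewrite xw.
  by move=> -> ->; rewrite -/(D k w') (wrask_bregman_past sp) Dw mul0r.
have pmfE' j : pmf P (fun w => (past k w, i k w)) (past k w, j) =
    wrask_prob p A b (x k w) j * pmf P (past k) (past k w).
  rewrite {1}/pmf past_next_fiber past_fiber (wrask_law W) // -past_fiber.
  by rewrite -(pmfE P (@measurable_past k)) -EFinM.
set pr := pmf P (past k) (past k w).
have pr0 : 0 <= pr by exact: pmf_ge0 (@measurable_past k) _.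
apply: (@le_trans _ _ ((\sum_j wrask_prob p A b (x k w) j *
    (D k w - (dot (arow A j) (x k w) - b j 0) ^+ 2 / 2)) * pr)).
  rewrite mulr_suml; apply: ler_sum => j _; rewrite -/pr.
  have [[w' [ww' ij]]|nw] := pselect (exists w', past k w' = past k w /\ i k w' = j);
    last first.
    (* If [j] never follows this past, its probability times the mass of the past is 0, so both
       sides vanish. *)
    have := pmfE' j; rewrite pmf_eq0 => [E|w' [ww' ij]]; last by apply: nw; exists w'.
    by rewrite mulr0 mulrAC -/pr -E mul0r.
  have sp := past_eq_same_past ww'; have xw := wrask_iterate_past sp.
  rewrite pmfE' -/pr mulrA ler_wpM2r // mulrC.
  apply: ler_wpM2l.
    by rewrite /wrask_prob divr_ge0 ?powR_ge0 // sumr_ge0 // => l _; exact: powR_ge0.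
  rewrite -ww' -ij -g'E; apply: le_trans (wrask_bregman_step lam_ge0 Axhat An _) _.
    by rewrite xw.
  by rewrite xw (wrask_bregman_past sp).
rewrite mulrA; apply: ler_wpM2r => //.
apply: le_trans (mean_descent p_gt0 Axhat Ax (D0 k w)) _.
set rr := dot _ _; have Drr : D k w / c <= rr by rewrite ler_pdivrMr // mulrC; exact: Dc.
by have := ler_wpM2l Q0 Drr; rewrite qE; lra.
Qed.

Lemma wrask_expectation_norm (lam_ge0 : 0 <= lam) (k : nat) (c : R) : 0 < c ->
  ('E_P[D k] <= (c ^+ 2 / 2)%:E)%E ->
  ('E_P[fun w => l2norm (x k w - xhat)] <= c%:E)%E.
Proof.
move=> c0.
have [|g [g0 gE ->]] := expectation_factor P (@measurable_past k) (@wrask_bregman_ge0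
  lam_ge0 k).
  by move=> w w' /past_eq_same_past; exact: wrask_bregman_past.
have [||g' [g'0 g'E ->]] := @expectation_factor _ _ _ P _ (past k) (@measurable_past k)
  (fun w => l2norm (x k w - xhat)).
- by move=> w; exact: sqrtr_ge0.
- by move=> w w' /past_eq_same_past /wrask_iterate_past ->.
(* X <= X^2 / (2 c) + c / 2 replaces Jensen's inequality. *)
rewrite !lee_fin => Dc.
have : \sum_s g' s * pmf P (past k) s <= \sum_s (g s / c + c / 2) * pmf P (past k) s.
  apply: ler_sum => s _.
  have [[w <-]|ns] := pselect (exists w, past k w = s); last first.
    by rewrite pmf_eq0 ?mulr0 // => w ws; apply: ns; exists w.
  apply: ler_wpM2r; first exact: pmf_ge0 (@measurable_past k) _.
  rewrite -gE -g'E; set X := l2norm _.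
  have X2 : X ^+ 2 / 2 <= D k w.
    have := bregman_ge lam_ge0 xhat (wrask_shrinkage k w).
    by rewrite /X l2norm_sqr -opprB dotNl dotNr opprK.
  have -> : D k w / c + c / 2 = (2 * D k w + c ^+ 2) / (2 * c).
    by field; rewrite gt_eqF.
  rewrite ler_pdivlMr ?mulr_gt0 //.
  by have := sqr_ge0 (X - c); nra.
have -> : \sum_s (g s / c + c / 2) * pmf P (past k) s =
    (\sum_s g s * pmf P (past k) s) / c + c / 2.
  rewrite -[X in _ + X]mulr1 -(sum_pmf P (@measurable_past k)) mulr_suml mulr_sumr
    -big_split.
  by apply: eq_bigr => s _ /=; rewrite mulrDl mulrAC.
move=> H; apply: le_trans H _.
have : (\sum_s g s * pmf P (past k) s) / c <= c / 2.
  by rewrite ler_pdivrMr // mulrAC -expr2.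
lra.
Qed.

End Wrask.
End Process.

Theorem theorem1 (R : realType) (p lam : R) (m n : nat)
    (A : 'M[R]_(m, n)) (b : 'cV[R]_m)
    (p_gt0 : 0 < p) (lam_ge0 : 0 <= lam)
    (A_normalized : forall i, l2norm (arow A i) = 1)
    (b_neq0 : b <> 0) (b_range : exists x, A *m x = b) :
  exists xhat : 'cV[R]_n,
    [/\ unique (bp_solution lam A b) xhat,
        0 <= wrask_factor lam p A xhat < 1,
        forall (r : step_rule) (d : measure_display) (T : measurableType d)
               (P : probability T R) (i : nat -> T -> 'I_m)
               (x xs : nat -> T -> 'cV[R]_n),
          wrask lam r p A b P i x xs ->
          forall k : nat,
            ('E_P[fun w => bregman lam (xs k.+1 w) (x k.+1 w) xhat]
               <= (wrask_factor lam p A xhat)%:E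
                  * 'E_P[fun w => bregman lam (xs k w) (x k w) xhat])%E
            /\
            ('E_P[fun w => l2norm (x k w - xhat)]
               <= ((wrask_factor lam p A xhat) `^ (k%:R / 2)
                   * Num.sqrt (2 * lam * l1norm xhat + l2norm xhat ^+ 2))%:E)%E
      & [/\ m%:R^-1 <= norm_quotient_inf p A,
            wrask_factor lam p A xhat <= rask_factor lam A xhat
          & forall z : 'cV[R]_n, A *m z != 0 ->
              (norm_quotient p A z = m%:R^-1 <->
               exists (c : R) (u : 'cV[R]_m),
                 (forall j, `|u j 0| = 1) /\ A *m z = c *: u)]].
Proof.
have [x0 Ax0] := b_range.
have [y0] := exists_dual_solution lam_ge0 A x0.
set xhat := soft_shrinkage _ _; rewrite Ax0 => Axhat.
have xhat0 : xhat != 0.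
  by apply/eqP => x0'; apply: b_neq0; rewrite -Axhat x0' mulmx0.
have A0 : A != 0 by apply/eqP => A0; apply: b_neq0; rewrite -Axhat A0 mul0mx.
have [qb qle] := wrask_factor_bounds lam_ge0 p_gt0 A0 xhat0 A_normalized.
have [q0 q1] := andP qb.
have [mu0 mule] := absminP xhat0.
have Qge := norm_quotient_inf_ge p_gt0 A0.
have Q0 : 0 <= norm_quotient_inf p A by apply: le_trans Qge; rewrite invr_ge0.
exists xhat; split.
- exact: (@unique_bp_solution _ _ _ _ _ _ lam_ge0 xhat y0).
- by rewrite ltW.
- move=> r d T P i x xs W.
  set q := wrask_factor lam p A xhat in q0 q1 *.
  pose c := absmin xhat / (absmin xhat + 2 * lam).
  have cden : 0 < absmin xhat + 2 * lam by lra.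
  have c0 : 0 < c by rewrite divr_gt0.
  have c1 : c <= 1 by rewrite ler_pdivrMr //; lra.
  (* The ratio [u / (u + 2 * lam)] is nondecreasing in [u > 0], so the smallest nonzero entry gives
     a constant valid for all. *)
  have cx j : xhat j 0 != 0 -> c * (`|xhat j 0| + 2 * lam) <= `|xhat j 0|.
    move=> /mule xj; rewrite mulrAC ler_pdivrMr //; nra.
  have S0 : 0 < sigma_tilde_min A ^+ 2 by rewrite exprn_gt0 // sigma_tilde_min_gt0.
  have cS0 : 0 < c * sigma_tilde_min A ^+ 2 by rewrite mulr_gt0.
  have step k := @wrask_expectation_step _ _ _ _ _ _ _ _ _ _ P i x xs W xhat lam_ge0
    p_gt0 q
    (c * sigma_tilde_min A ^+ 2)^-1 k Axhat A_normalized.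
  have {}step k : ('E_P[fun w => bregman lam (xs k.+1 w) (x k.+1 w) xhat]
      <= q%:E * 'E_P[fun w => bregman lam (xs k w) (x k w) xhat])%E.
    apply: step => //; first by rewrite invr_gt0.
      move=> w; have [y xsE] := wrask_dual_range W k w.
      have xE := wrask_shrinkage W k w; rewrite xsE in xE.
      rewrite ler_pdivlMl // xsE -Axhat.
      exact: (error_bound lam_ge0 (erefl xhat) (ltW c0) c1 cx xE).
    by rewrite /q /wrask_factor -/c invrK; ring.
  move=> k; split; first exact: step.
  (* [B / 2] is the objective at [xhat], which is the Bregman distance from the zero start. *)
  set B := 2 * lam * l1norm xhat + l2norm xhat ^+ 2.
  have B0 : 0 < B.
    have l20 : 0 < l2norm xhat ^+ 2 by rewrite l2norm_sqr dot_gt0.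
    have l10 : 0 <= lam * l1norm xhat by rewrite mulr_ge0 // sumr_ge0.
    by rewrite /B; lra.
  apply: (wrask_expectation_norm W lam_ge0).
    by rewrite mulr_gt0 ?sqrtr_gt0 // powR_gt0.
  have -> : (q `^ (k%:R / 2) * Num.sqrt B) ^+ 2 / 2 = q ^+ k * (B / 2).
    rewrite exprMn sqr_sqrtr ?(ltW B0) // -mulrA; congr (_ * _).
    by rewrite -[LHS]powR_mulrn ?powR_ge0 // -powRrM divfK // powR_mulrn // ltW.
  elim: k => [|k IHk].
    rewrite expr0 mul1r (_ : (fun w => _) = cst (B / 2)) ?expectation_cst //.
    apply/funext => w /=; have [-> ->] := wrask_init W w.
    rewrite /bregman dot0l subr0 (objectiveE _ 0) big1 => [|j _].
      by rewrite subr0 /objective /B; lra.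
    by rewrite mxE normr0 expr0n mulr0 mul0r addr0.
  apply: le_trans (step k) _; rewrite exprS -mulrA EFinM.
  by apply: lee_wpmul2l => //; rewrite lee_fin ltW.
- split=> // z Az0; exact: norm_quotient_eq.
Qed.
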